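(* Let $G_{V,01}^t, \chi_V^t$ be the two-point function and susceptibility for trees, and $G_{V,01}^a, \chi_V^a$ those for connected subgraphs, on the complete graph $\mathbb{K}_V$ (as defined in the context), and let $$I(s) = \frac{e}{\sqrt{2\pi}}\int_0^\infty e^{-\frac12 x^2+sx}\frac{1}{\sqrt{x}}\,\mathrm{d}x \qquad (s\in\mathbb{R}).$$ Then, both for trees (superscript $*=t$) and for connected subgraphs (superscript $*=a$), and for every $s\in\mathbb{R}$, as $V\to\infty$, $$G_{V,01}^{*}(1+sV^{-1/2}) \sim V^{-3/4} I(s), \qquad \chi_V^{*}(1+sV^{-1/2}) \sim V^{1/4} I(s).$$
   Context: For an integer $V\ge 2$, $\mathbb{K}_V$ is the complete graph with labelled vertex set $\{0,1,\dots,V-1\}$ and edge set $\{\{x,y\}: x\ne y\}$. A subgraph consists of a nonempty vertex subset together with a set of edges between those vertices; a tree is a connected acyclic subgraph. The single-vertex subgraph with no edges is a tree (and a connected subgraph). $|T|$, $|A|$ denote the number of edges of $T$, $A$. One-point functions: $G_{V,0}^t(p)=\sum_{T\ni 0}\left(\frac{p}{eV}\right)^{|T|}$, $G_{V,0}^a(p)=\sum_{A\ni 0}\left(\frac{p}{eV}\right)^{|A|}$, where the first sum is over all trees $T$ in $\mathbb{K}_V$ containing the vertex $0$ and the second is over all connected subgraphs $A$ of $\mathbb{K}_V$ containing the vertex $0$. Two-point functions: $G_{V,01}^t(p)=\sum_{T\ni 0,1}\left(\frac{p}{eV}\right)^{|T|}$, $G_{V,01}^a(p)=\sum_{A\ni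 0,1}\left(\frac{p}{eV}\right)^{|A|}$, where the sums are over trees, respectively connected subgraphs, containing both vertices $0$ and $1$. Susceptibility: $\chi_V^{*}(p)=G_{V,0}^{*}(p)+(V-1)G_{V,01}^{*}(p)$ for $*\in\{t,a\}$. Here $e$ is the base of natural logarithms, and $f\sim g$ means $\lim f/g=1$. *)

(* Defs.v *)
From HB Require Import structures.
From mathcomp Require Import all_boot all_order all_algebra.
From mathcomp Require Import all_classical all_reals all_analysis.
Set Implicit Arguments.
Unset Strict Implicit.
Unset Printing Implicit Defensive.
Import Order.TTheory GRing.Theory Num.Theory.
Import numFieldNormedType.Exports.
Local Open Scope ring_scope.

(* A pair (W, E) of a vertex set and a set of edges; edges are unordered pairs
   of vertices.  The constraints linking W and E are in [is_subgraph]. *)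
Definition graph_on (V : nat) : finType :=
  ({set 'I_V} * {set {set 'I_V}})%type.

Section Graphs.
Variable V : nat.
Implicit Type A : graph_on V.

Definition vertices A : {set 'I_V} := A.1.
Definition edges A : {set {set 'I_V}} := A.2.

Definition is_subgraph A : bool :=
  (vertices A != finset.set0) &&
  [forall e in edges A, (#|e| == 2%N) && (e \subset vertices A)].

Definition adj A : rel 'I_V := fun x y => [set x; y]%SET \in edges A.

Definition is_connected A : bool :=
  [forall x in vertices A, forall y in vertices A, connect (adj A) x y].

(* No closed walk through at least three pairwise distinct vertices. *)
Definition is_acyclic A : bool :=
  `[< forall c : seq 'I_V, (2 < size c)%N -> ~~ ucycleb (adj A) c >].

(* Vertices are labelled 0, ..., V-1, so no vertex is labelled k when V <= k. *)
Definition contains A (k : nat) : bool := [exists x in vertices A, val x == k].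

End Graphs.

Definition connected_subgraphs (V : nat) : {set graph_on V} :=
  [set A : graph_on V | is_subgraph A && is_connected A]%SET.

Definition trees (V : nat) : {set graph_on V} :=
  [set A : graph_on V | [&& is_subgraph A, is_connected A & is_acyclic A]]%SET.

Section GeneratingFunctions.
Variables (R : realType) (F : forall V : nat, {set graph_on V}).

Definition weight (V : nat) (p : R) (A : graph_on V) : R :=
  (p / (expR 1 * V%:R)) ^+ #|edges A|.

Definition one_point (V : nat) (p : R) : R :=
  \sum_(A in F V | contains A 0) weight p A.

Definition two_point (V : nat) (p : R) : R :=
  \sum_(A in F V | contains A 0 && contains A 1) weight p A.

Definition susceptibility (V : nat) (p : R) : R :=
  one_point V p + (V%:R - 1) * two_point V p.

End GeneratingFunctions.

Definition profile (R : realType) (s : R) : R :=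
  expR 1 / Num.sqrt (2 * pi) *
  \int[@lebesgue_measure R]_(x in `]0%R, +oo[%classic)
    (expR (- (1 / 2) * x ^+ 2 + s * x) * (1 / Num.sqrt x)).

Definition window (R : realType) (s : R) (V : nat) : R :=
  1 + s * V%:R `^ (- (1 / 2)).

(* [f ~ g] as V -> oo, in the sense lim f / g = 1. *)
Definition asymp_equiv (R : realType) (f g : nat -> R) : Prop :=
  ((fun V : nat => f V / g V) @ \oo --> (1 : R))%classic.

(* Main.v *)
Require Import Defs.
From mathcomp Require Import all_boot all_order all_algebra.
From mathcomp Require Import all_classical all_reals all_analysis.
From mathcomp Require Import perm measurable_realfun zify ring lra.
Set Implicit Arguments.
Unset Strict Implicit.
Unset Printing Implicit Defensive.
Import Order.TTheory GRing.Theory Num.Theory.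
Import numFieldNormedType.Exports.
Local Open Scope ring_scope.

(** Write [V = N + 2] and [z = p / (e V)]. A tree or connected subgraph that
    contains 0 and 1 and has [n = m + 2] vertices has one of ['C(N, m)] vertex
    sets, so the two-point function is the sum over [m] of ['C(N, m)] times the
    total weight of the spanning trees, or connected spanning graphs, of [n]
    given vertices.

    For trees that weight is [n^(n-2) z^(n-1)] by Cayley's formula
    ([sum_spanning_trees]). When [p = 1 + s V^(-1/2)] and [n] is close to
    [x V^(1/2)], the factor ['C(N, m) m! / V^m] tends to [exp (- x^2 / 2)], the
    factor [p^(n-1)] to [exp (s x)], and Stirling's formula turns
    [n^n e^(-n) / n!] into [1 / sqrt (2 pi n)]. Hence the term is asymptotic to
    [V^(-5/4) (e / sqrt (2 pi)) exp (- x^2 / 2 + s x) / sqrt x]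
    ([scaled_term_cvg]), and [V^(3/4)] times the sum is a Riemann sum of mesh
    [V^(-1/2)] for [I(s)]. The passage to the limit is dominated convergence for
    step functions on the half-line; it is done once, for sums whose terms carry
    an additional factor [h m] ([two_point_sum_cvg]).

    Connected graphs that are not trees are negligible. Such a graph on [n]
    vertices is a connected graph with exactly [n] edges plus a set of further
    edges, so the weight added to that of the trees is at most
    [c z^n (1 + z)^('C(n, 2))], where [c] is the number of connected graphs with
    [n] edges. As [(1 + z)^('C(n, 2)) <= exp (z n^2 / 2)] and [z n^2] is about
    [x^2 / e], the last factor costs only a part of the Gaussian decay. So it is
    enough that [c = o(n^n)]; [card_unicyclic_le] gives [c = O(n^(n - 1/4))].
    A connected graph with [n] edges is the graph of a map with one cycle. There
    are at most [l n^(n-1)] such maps with a cycle of length [l], so short cycles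
    are rare, and the lengths of the cycles of all these maps add up to at most
    [n^n], so long cycles are rare too. Both counts come from rooted
    forests, seen as maps whose only cycles are fixed points, and from Pitman's
    recursion for their number ([card_forests_step]), which yields Cayley's
    formula as well.

    In the one-point function the term of index [m] has the further factor
    [(N + 1) / (m + 1)]. The same limit theorem, with [1 / (m + 1)] included in
    [h m] so that its limit is 0, shows that the one-point function is
    [o(V^(1/4))]. Therefore the susceptibility is
    asymptotic to [V] times the two-point function. *)

(** * Rooted forests as maps *)

Section RootedForests.
Import fintype boot.finset.
Local Open Scope nat_scope.
Local Open Scope set_scope.
Variable T : finType.
Implicit Types (W : {set T}) (f g M : {ffun T -> T}) (x y z r : T).

Definition upd f x y : {ffun T -> T} := [ffun z => if z == x then y else f z].

(** Self-maps of [W], extended by the identity so that the maps of all the sets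
    [W] live in one finite type. *)
Definition maps W : {set {ffun T -> T}} :=
  [set f : {ffun T -> T} | [forall x, if x \in W then f x \in W else f x == x]].

(** [#|T|] steps are enough to enter a cycle, hence to reach the root when the
    only cycles are fixed points. *)
Definition endpoint f x := iter #|T| f x.

(** A rooted forest is encoded by its parent map, the roots being fixed; points
    outside the vertex set are then harmless isolated roots. *)
Definition forest f := [forall x, f (endpoint f x) == endpoint f x].

Definition roots W f := [set x in W | f x == x].

Definition forests W k :=
  [set f in maps W | forest f && (#|roots W f| == k)].

Lemma in_forests W k f : (f \in forests W k) =
  [&& f \in maps W, forest f & #|roots W f| == k].
Proof. by rewrite !inE. Qed.

Lemma mapsP W f :
  reflect ((forall x, x \in W -> f x \in W) /\ (forall x, x \notin W -> f x = x))
          (f \in maps W).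
Proof.
rewrite inE; apply: (iffP forallP) => [H | [H1 H2] x].
  by split=> x xW; have := H x; [rewrite xW | rewrite (negPf xW) => /eqP].
by case: ifPn => xW; [apply: H1 | apply/eqP/H2].
Qed.

Lemma iter_maps W f x i : f \in maps W -> x \in W -> iter i f x \in W.
Proof. by move=> /mapsP[fW _] xW; elim: i => //= i; apply: fW. Qed.

Lemma reachP f x y : reflect (exists i, iter i f x = y) (fconnect f x y).
Proof.
apply: (iffP idP) => [/iter_findex <- | [i <-]]; first by eexists.
exact: fconnect_iter.
Qed.

Lemma endpoint_eq f x r : fconnect f x r -> f r = r -> endpoint f x = r.
Proof.
move=> xr fr; have lt_i : findex f x r <= #|T|.
  by apply: ltnW; apply: leq_trans (findex_max xr) _; apply: max_card.
by rewrite /endpoint -(subnK lt_i) iterD iter_findex // iter_fix.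
Qed.

Lemma connect_endpoint f x : fconnect f x (endpoint f x).
Proof. exact: fconnect_iter. Qed.

Lemma forestP f :
  reflect (forall x, exists2 r, fconnect f x r & f r = r) (forest f).
Proof.
apply: (iffP forallP) => [H x | H x].
  by exists (endpoint f x); [apply: connect_endpoint | apply/eqP].
by have [r xr fr] := H x; rewrite (endpoint_eq xr fr) fr.
Qed.

Lemma forest_endpoint f x : forest f -> f (endpoint f x) = endpoint f x.
Proof. by move=> /forallP/(_ x)/eqP. Qed.

Lemma endpoint_roots W f x :
  f \in maps W -> forest f -> x \in W -> endpoint f x \in roots W f.
Proof.
by move=> fW ff xW; rewrite inE iter_maps //= forest_endpoint.
Qed.

(** The root of a periodic point leads back to that point, so they are equal. *)
Lemma forest_periodic f x : forest f -> fconnect f (f x) x -> f x = x.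
Proof.
move=> ff /reachP[a]; rewrite -iterSr => Hx.
have per m : iter (m * a.+1) f x = x.
  by elim: m => // m IH; rewrite mulSn iterD IH.
suff <- : endpoint f x = x by apply: forest_endpoint.
have leT : #|T| <= #|T| * a.+1 by rewrite leq_pmulr.
rewrite -{2}(per #|T|) -(subnK leT) iterD.
by rewrite [RHS]iter_fix //; apply: forest_endpoint.
Qed.

Lemma upd_connect_fix f x z : fconnect (upd f x x) z x -> fconnect f z x.
Proof.
case/reachP=> i; elim: i z => [z <- //|i IH z]; rewrite iterSr ffunE.
case: eqP => [-> //|_ /IH]; exact/connect_trans/fconnect1.
Qed.

Lemma connect_upd f x y z : fconnect f z x -> fconnect (upd f x y) z x.
Proof.
case/reachP=> i; elim: i z => [z <- //|i IH z]; rewrite iterSr.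
have [-> //|zx /IH] := eqVneq z x; apply: connect_trans.
by apply: connect1; rewrite /= ffunE (negPf zx).
Qed.

Lemma connect_updN f x y z r :
  fconnect f z r -> ~~ fconnect f z x -> fconnect (upd f x y) z r.
Proof.
case/reachP=> i; elim: i z => [z <- //|i IH z]; rewrite iterSr => Hi zx.
have zNx : z != x by apply: contraNneq zx => ->.
apply: (@connect_trans _ _ (f z)).
  by apply: connect1; rewrite /= ffunE (negPf zNx).
apply: IH Hi _; apply: contra zx; exact/connect_trans/fconnect1.
Qed.

Lemma endpoint_connect f x z : f x = x -> forest f ->
  fconnect f z x = (endpoint f z == x).
Proof.
move=> fx ff; apply/idP/eqP => [zx | <-]; last exact: connect_endpoint.
exact: endpoint_eq.
Qed.

(** Paths that met [x] now stop there, the others are unchanged. *)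
Lemma forest_cut f x : forest f -> forest (upd f x x).
Proof.
move=> /forestP ff; apply/forestP => z.
have [zx|zx] := boolP (fconnect f z x).
  by exists x; [apply: connect_upd | rewrite ffunE eqxx].
have [r zr fr] := ff z; exists r; first exact: connect_updN.
by rewrite ffunE; case: eqP => [<-|].
Qed.

(** Paths that met [x] continue from [y] to the root of [y]. As this root is not
    [x], no cycle is closed. *)
Lemma forest_join f x y :
  forest f -> f x = x -> endpoint f y != x -> forest (upd f x y).
Proof.
move=> ff fx yx; apply/forestP => z.
have yNx : ~~ fconnect f y x by rewrite endpoint_connect.
have root r : r != x -> f r = r -> upd f x y r = r.
  by move=> rx fr; rewrite ffunE (negPf rx).
have [zx|zx] := boolP (fconnect f z x).
  exists (endpoint f y); last by apply: root => //; apply: forest_endpoint.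
  apply: connect_trans (connect_upd _ zx) _.
  apply: connect_trans (connect1 _) _; first by rewrite /= ffunE eqxx.
  by apply: connect_updN yNx; apply: connect_endpoint.
exists (endpoint f z).
  by apply: connect_updN => //; apply: connect_endpoint.
apply: root; last exact: forest_endpoint.
by rewrite -endpoint_connect.
Qed.

Lemma endpoint_join f x y : forest f -> f x = x -> endpoint f y != x ->
  endpoint (upd f x y) x = endpoint f y.
Proof.
move=> ff fx yx; apply: endpoint_eq; last first.
  by rewrite ffunE (negPf yx) forest_endpoint.
apply: connect_trans (connect1 _) _; first by rewrite /= ffunE eqxx.
by apply: connect_updN; [apply: connect_endpoint | rewrite endpoint_connect].
Qed.

Lemma endpoint_joinN f x y z : forest f -> f x = x -> endpoint f z != x ->
  endpoint (upd f x y) z = endpoint f z.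
Proof.
move=> ff fx zx; apply: endpoint_eq; last first.
  by rewrite ffunE (negPf zx) forest_endpoint.
by apply: connect_updN; [apply: connect_endpoint | rewrite endpoint_connect].
Qed.

Lemma maps_upd W f x y :
  f \in maps W -> x \in W -> y \in W -> upd f x y \in maps W.
Proof.
move=> /mapsP[f1 f2] xW yW; apply/mapsP; split=> z zW; rewrite ffunE.
  by case: eqP => // _; apply: f1.
by case: eqP zW => [->|_ zW]; [rewrite xW | apply: f2].
Qed.

Lemma roots_cut W f x : x \in W -> roots W (upd f x x) = x |: roots W f.
Proof.
move=> xW; apply/setP => z; rewrite !inE ffunE.
by have [->|] := eqVneq z x; rewrite ?xW ?eqxx.
Qed.

Lemma roots_join W f x y : x != y -> roots W (upd f x y) = roots W f :\ x.
Proof.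
move=> xy; apply/setP => z; rewrite !inE ffunE.
by have [->|] := eqVneq z x; rewrite ?(eq_sym y) ?(negPf xy) ?andbF.
Qed.

Lemma updK f x y : upd (upd f x y) x (f x) = f.
Proof. by apply/ffunP => z; rewrite !ffunE; case: eqP => [->|]. Qed.

(** Pitman's double count. Cutting below a non-root [x] of a forest with [k]
    roots is inverse to joining, in a forest with [k + 1] roots, a root [x] to
    a vertex [y] of another tree; each [y] leaves [k] choices for [x]. *)
Lemma card_forests_step W k :
  #|forests W k| * (#|W| - k) = #|forests W k.+1| * (k * #|W|).
Proof.
pose A := [set p : {ffun T -> T} * T | (p.1 \in forests W k) &&
             (p.2 \in W :\: roots W p.1)].
pose B := [set q : {ffun T -> T} * (T * T) | (q.1 \in forests W k.+1) &&
             ((q.2.2 \in W) && (q.2.1 \in roots W q.1 :\ endpoint q.1 q.2.2))].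
have cA : #|A| = #|forests W k| * (#|W| - k).
  rewrite -sum1_card (eq_bigl (fun p => (p.1 \in forests W k) &&
     (p.2 \in W :\: roots W p.1))); last by move=> p; rewrite inE.
  rewrite -(pair_big_dep (mem (forests W k)) (fun f x => x \in W :\: roots W f)
             (fun _ _ => 1)) /=.
  rewrite -sum_nat_const; apply: eq_bigr => f; rewrite in_forests.
  case/and3P=> _ _ /eqP <-; rewrite sum1_card cardsD.
  suff -> : W :&: roots W f = roots W f by [].
  by apply/setIidPr/subsetP => x; rewrite inE => /andP[].
have cB : #|B| = #|forests W k.+1| * (k * #|W|).
  rewrite -sum1_card (eq_bigl (fun q => (q.1 \in forests W k.+1) &&
     ((q.2.2 \in W) && (q.2.1 \in roots W q.1 :\ endpoint q.1 q.2.2))));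
    last by move=> p; rewrite inE.
  rewrite -(pair_big_dep (mem (forests W k.+1)) (fun f (p : T * T) =>
     (p.2 \in W) && (p.1 \in roots W f :\ endpoint f p.2)) (fun _ _ => 1)) /=.
  rewrite -sum_nat_const; apply: eq_bigr => f; rewrite in_forests.
  case/and3P=> fW ff /eqP cf.
  rewrite -(pair_big_dep xpredT (fun x y => (y \in W) &&
     (x \in roots W f :\ endpoint f y)) (fun _ _ => 1)) /=.
  rewrite (exchange_big_dep (mem W)) /=; last by move=> ? ? _ /andP[].
  rewrite mulnC -sum_nat_const; apply: eq_bigr => y yW.
  rewrite sum1_card; have := endpoint_roots fW ff yW.
  rewrite (cardsD1 (endpoint f y)) in cf => ey.
  by move: cf; rewrite ey => -[<-]; apply: eq_card => x; rewrite unfold_in yW.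
rewrite -cA -cB.
(* Cut below a non-root and remember the edge. *)
pose F (p : {ffun T -> T} * T) := (upd p.1 p.2 p.2, (p.2, p.1 p.2)).
have injF : injective F.
  move=> [f x] [g y] /= [] E exy; rewrite -{}exy in E * => fg.
  by congr pair; rewrite -(updK f x x) E fg updK.
rewrite -(card_imset _ injF); apply: eq_card => -[g [x y]].
apply/imsetP/idP => [[[f z]] | ].
  rewrite inE in_forests => /andP[/and3P[fW ff /eqP cf]] /=.
  case/setDP=> /= zW zR [-> -> ->].
  have fz : f z != z by move: zR; rewrite inE zW.
  have [f1 _] := mapsP _ _ fW; rewrite /= in fW ff cf f1.
  rewrite inE /= in_forests maps_upd // forest_cut //= f1 // roots_cut //.
  rewrite cardsU1 zR cf eqxx /= in_setD1 setU11 andbT eq_sym.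
  apply: contra fz => /eqP zE; apply/eqP; apply: forest_periodic => //.
  by apply: upd_connect_fix; rewrite -[X in fconnect _ _ X]zE connect_endpoint.
rewrite inE in_forests => /andP[/and3P[gW gf /eqP cg]] /=.
rewrite !inE => /and3P[yW xE /andP[xW /eqP gx]].
have xy : x != y.
  by apply: contraNneq xE => <-; rewrite /endpoint iter_fix.
exists (upd g x y, x); last first.
  by have := updK g x y; rewrite gx /F /= => ->; rewrite ffunE eqxx.
rewrite inE in_forests /= maps_upd // forest_join //=; last by rewrite eq_sym.
have xR : x \in roots W g by rewrite inE xW gx eqxx.
rewrite roots_join // in_setD in_setD1 eqxx xW andbT.
by move: cg; rewrite (cardsD1 x) xR add1n => -[->]; rewrite eqxx.
Qed.

Lemma leq_roots W f : #|roots W f| <= #|W|.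
Proof. by apply: subset_leq_card; apply/subsetP => x; rewrite inE => /andP[]. Qed.

Lemma card_forests_all_roots W : #|forests W #|W| | = 1.
Proof.
rewrite (_ : forests W _ = [set [ffun x => x]]) ?cards1 //.
apply/setP => f; rewrite in_forests in_set1; apply/and3P/eqP => [[fW _ rf] | ->].
  have [_ f2] := mapsP _ _ fW; apply/ffunP => x; rewrite ffunE.
  have [xW|/f2 //] := boolP (x \in W).
  have /eqP rW : roots W f == W.
    rewrite eqEcard (eqP rf) leqnn andbT.
    by apply/subsetP => z; rewrite inE => /andP[].
  by move: xW; rewrite -{1}rW inE => /andP[_ /eqP].
split.
- by apply/mapsP; split=> x xW; rewrite ffunE.
- by apply/forestP => x; exists x; rewrite ?connect0 ?ffunE.
- apply/eqP; congr #|pred_of_set _|; apply/setP => x.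
  by rewrite inE ffunE eqxx andbT.
Qed.

(** Solution of the recursion [card_forests_step], started at the forest without
    edges and cleared of divisions. *)
Lemma card_forests_fact W j : j < #|W| ->
  #|forests W (#|W| - j)| * (#|W| - j).-1`! * j`! = #|W| ^ j * (#|W|.-1)`!.
Proof.
elim: j => [|j IH] ltj.
  by rewrite subn0 card_forests_all_roots fact0 expn0 muln1.
have := IH (ltnW ltj); have := card_forests_step W (#|W| - j.+1).
have -> : #|W| - j = (#|W| - j.+1).+1 by lia.
set k := #|W| - j.+1; have kn : #|W| - k = j.+1 by rewrite /k; lia.
have k0 : 0 < k by rewrite /k; lia.
rewrite kn [#|W| ^ j.+1]expnS -[#|W| * _ * _]mulnA => H1 <-.
have fk : k`! = k * k.-1`! by rewrite -{1}(prednK k0) factS prednK.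
rewrite [j.+1`!]factS [k.+1.-1]/= fk; clear -H1.
transitivity (#|forests W k| * j.+1 * (k.-1`! * j`!)); first by ring.
by rewrite H1; ring.
Qed.

Lemma card_rooted_trees W : 0 < #|W| -> #|forests W 1| = #|W| ^ #|W|.-1.
Proof.
move=> W0; have := @card_forests_fact W #|W|.-1; rewrite prednK // => /(_ (leqnn _)).
have -> : #|W| - #|W|.-1 = 1 by lia.
rewrite fact0 muln1 => /eqP; rewrite eqn_pmul2r ?fact_gt0 // => /eqP; exact.
Qed.

(** From [k] to [k + 1] the left-hand side is multiplied by
    [(#|W| - k) / #|W| <= 1], by [card_forests_step]. *)
Lemma card_forests_bound W k :
  0 < k -> #|forests W k| * k.-1`! <= #|W| ^ #|W|.-1.
Proof.
case: (posnP #|W|) => [W0|W0].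
  move=> k0; rewrite [#|forests W k|](_ : _ = 0) //; apply: eq_card0 => f.
  rewrite in_forests; apply/negbTE/and3P => -[_ _ /eqP rk].
  by have := leq_roots W f; rewrite rk W0 leqNgt k0.
elim: k => // -[_ _ | k IH _]; first by rewrite fact0 muln1 card_rooted_trees.
apply: leq_trans (IH isT); rewrite -(leq_pmul2r W0) /= factS.
have -> : #|forests W k.+2| * (k.+1 * k`!) * #|W| =
          #|forests W k.+1| * (#|W| - k.+1) * k`!.
  by rewrite card_forests_step; ring.
by rewrite mulnAC leq_mul2l leq_subr orbT.
Qed.

(** A point reached from all of [W] lies on every cycle. So this is the cycle of
    the map if there is only one, and empty otherwise. *)
Definition cyclic_points W M := [set x in W | [forall y in W, fconnect M y x]].

Definition unicyclic_maps W := [set M in maps W | cyclic_points W M != set0].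

Lemma cyclic_pointsP W M x :
  reflect (x \in W /\ (forall y, y \in W -> fconnect M y x)) (x \in cyclic_points W M).
Proof. by rewrite inE; apply: (iffP andP) => -[xW] /forall_inP. Qed.

Lemma cyclic_step W M x :
  M \in maps W -> x \in cyclic_points W M -> M x \in cyclic_points W M.
Proof.
move=> /mapsP[M1 _] /cyclic_pointsP[xW xc]; apply/cyclic_pointsP.
split; first exact: M1.
by move=> y yW; apply: connect_trans (xc y yW) (fconnect1 _ _).
Qed.

(** The map sends the cyclic points onto themselves. *)
Lemma cyclic_inj W M : M \in maps W -> {in cyclic_points W M &, injective M}.
Proof.
move=> MW; have [M1 _] := mapsP _ _ MW.
apply/imset_injP; rewrite eqn_leq leq_imset_card /= subset_leq_card //.
apply/subsetP => x xc; have [xW xr] := cyclic_pointsP _ _ _ xc.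
have /reachP[i] := xr _ (M1 _ xW); rewrite -iterSr iterS => Hi.
apply/imsetP; exists (iter i M x) => //.
by elim: i {Hi} => //= i; apply: cyclic_step.
Qed.

(** Cutting the map at a cyclic point [c] leaves a tree rooted at [c], and the
    edge that was cut led to a vertex of [W]. The tree and this vertex determine
    the map and [c]. *)
Lemma sum_card_cyclic_points W : 0 < #|W| ->
  \sum_(M in maps W) #|cyclic_points W M| <= #|W| ^ #|W|.
Proof.
move=> W0; pose A := [set p : {ffun T -> T} * T | (p.1 \in maps W) &&
             (p.2 \in cyclic_points W p.1)].
have -> : \sum_(M in maps W) #|cyclic_points W M| = #|A|.
  rewrite -[RHS]sum1_card [RHS](eq_bigl (fun p => (p.1 \in maps W) &&
     (p.2 \in cyclic_points W p.1))); last by move=> p; rewrite inE.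
  rewrite -(pair_big_dep (mem (maps W)) (fun f x => x \in cyclic_points W f)
             (fun _ _ => 1)) /=.
  by apply: eq_bigr => f _; rewrite sum1_card.
pose F (p : {ffun T -> T} * T) :=
  (upd p.1 (endpoint p.1 p.2) p.2, endpoint p.1 p.2).
have sAF : A \subset F @: setX (forests W 1) W.
  apply/subsetP => -[M c]; rewrite inE => /andP[/= MW cc].
  have [cW cr] := cyclic_pointsP _ _ _ cc; have [M1 _] := mapsP _ _ MW.
  have reach y : y \in W -> fconnect (upd M c c) y c.
    by move=> yW; apply/connect_upd/cr.
  have fixc : upd M c c c = c by rewrite ffunE eqxx.
  apply/imsetP; exists (upd M c c, M c); last first.
    by rewrite /F /= (endpoint_eq (reach _ (M1 _ cW)) fixc) updK.
  rewrite inE /= M1 // andbT in_forests maps_upd //=; apply/andP; split.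
    apply/forestP => y; have [yW|yW] := boolP (y \in W).
      by exists c; [apply: reach|].
    exists y; rewrite ?connect0 // ffunE.
    by case: eqP yW => [-> /negP//|_]; case/mapsP: MW => _; apply.
  rewrite (_ : roots _ _ = [set c]) ?cards1 //; apply/setP => z.
  rewrite in_set1 inE; apply/andP/eqP => [[zW /eqP zf] | ->]; last first.
    by rewrite cW fixc.
  by have := endpoint_eq (reach _ zW) fixc; rewrite /endpoint iter_fix.
apply: leq_trans (subset_leq_card sAF) _; apply: leq_trans (leq_imset_card _ _) _.
by rewrite cardsX card_rooted_trees // mulnC -expnS prednK.
Qed.

(** A map with one cycle is determined by the forest rooted at its cyclic points
    and by a permutation of these points. *)
Lemma card_maps_cyclic_points W l : 0 < l ->
  #|[set M in maps W | #|cyclic_points W M| == l]| <= #|forests W l| * l`!.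
Proof.
move=> l0; pose X := [set p : {ffun T -> T} * {perm T} |
  (p.1 \in forests W l) && (perm_on (roots W p.1) p.2)].
have cX : #|X| = #|forests W l| * l`!.
  rewrite -[LHS]sum1_card [LHS](eq_bigl (fun p => (p.1 \in forests W l) &&
     (perm_on (roots W p.1) p.2))); last by move=> p; rewrite inE.
  rewrite -(pair_big_dep (mem (forests W l))
    (fun f (s : {perm T}) => perm_on (roots W f) s) (fun _ _ => 1)) /=.
  rewrite -sum_nat_const; apply: eq_bigr => f; rewrite in_forests.
  by case/and3P=> _ _ /eqP <-; rewrite sum1_card card_perm.
pose F (p : {ffun T -> T} * {perm T}) : {ffun T -> T} :=
  [ffun x => if x \in roots W p.1 then p.2 x else p.1 x].
rewrite -cX; suff sXF : [set M in maps W | #|cyclic_points W M| == l] \subset F @: X.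
  exact: leq_trans (subset_leq_card sXF) (leq_imset_card _ _).
apply/subsetP => M; rewrite inE => /andP[MW /eqP cl].
have [M1 M2] := mapsP _ _ MW.
have [c cc] : exists c, c \in cyclic_points W M.
  by apply/set0Pn; rewrite -card_gt0 cl.
have [cW cr] := cyclic_pointsP _ _ _ cc.
pose g : {ffun T -> T} := [ffun x => if x \in cyclic_points W M then x else M x].
have injs : injective (fun x => if x \in cyclic_points W M then M x else x).
  move=> x y; case: ifP => xc; case: ifP => yc //.
    by move=> E; apply: (cyclic_inj MW).
    by move=> E; move: yc; rewrite -E cyclic_step.
  by move=> E; move: xc; rewrite E cyclic_step.
have rg : roots W g = cyclic_points W M.
  apply/setP => x; rewrite inE ffunE; case: ifPn => [xc | xc].
    by have [-> _] := cyclic_pointsP _ _ _ xc; rewrite eqxx.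
  apply/negbTE; apply: contra xc => /andP[xW /eqP Mx].
  by have /reachP[i] := cr _ xW; rewrite iter_fix // => ->.
apply/imsetP; exists (g, perm injs); last first.
  apply/ffunP => x; rewrite ffunE /= rg permE ffunE.
  by case: (x \in cyclic_points W M).
rewrite inE /= in_forests rg cl eqxx andbT; apply/andP; split; last first.
  by apply/subsetP => x; rewrite unfold_in permE; case: ifP => // _; rewrite eqxx.
apply/andP; split.
  apply/mapsP; split=> x xW; rewrite ffunE; case: ifP => // _; last exact: M2.
  exact: M1.
apply/forestP => x; have [xW|xW] := boolP (x \in W); last first.
  by exists x; rewrite ?connect0 // ffunE; case: ifP => // _; apply: M2.
have /reachP[i] := cr _ xW; elim: i x xW => [x xW /= -> | i IH x xW].
  by exists c; rewrite ?connect0 // ffunE cc.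
rewrite iterSr => /(IH _ (M1 _ xW))[r rM gr].
have [xc|xc] := boolP (x \in cyclic_points W M).
  by exists x; rewrite ?connect0 // ffunE xc.
exists r => //; apply: connect_trans rM.
by apply: connect1; rewrite /= ffunE (negPf xc).
Qed.

(** Maps with at most [L] cyclic points are bounded through forests, the others
    by Markov's inequality for [sum_card_cyclic_points]. *)
Lemma card_unicyclic_maps W L : 0 < #|W| ->
  #|unicyclic_maps W| * L.+1 <= L.+1 ^ 3 * #|W| ^ #|W|.-1 + #|W| ^ #|W|.
Proof.
move=> W0.
pose A := [set M in unicyclic_maps W | #|cyclic_points W M| <= L].
pose B := [set M in unicyclic_maps W | L < #|cyclic_points W M| ].
have -> : #|unicyclic_maps W| = #|A| + #|B|.
  rewrite -(cardsID [set M | #|cyclic_points W M| <= L] (unicyclic_maps W)).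
  by congr (_ + _); apply: eq_card => M; rewrite !inE ?ltnNge // andbC.
rewrite mulnDl leq_add //; last first.
  apply: leq_trans (sum_card_cyclic_points W0); rewrite -sum_nat_const.
  rewrite [leqRHS](bigID (fun M => M \in B)) /= -[leqLHS]addn0 leq_add //.
  rewrite (eq_bigl (fun M => (M \in maps W) && (M \in B))).
    by apply: leq_sum => M /andP[_]; rewrite inE => /andP[].
  by move=> M; rewrite !inE; case: [forall _, _].
have sA : A \subset
    \bigcup_(l < L.+1 | 0 < l) [set M in maps W | #|cyclic_points W M| == l].
  apply/subsetP => M; rewrite 2!inE => /andP[/andP[MW c0] cL].
  apply/bigcupP; exists (Ordinal (cL : #|cyclic_points W M| < L.+1)) => /=.
    by rewrite card_gt0.
  by rewrite inE MW eqxx.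
have: #|A| <= \sum_(l < L.+1 | 0 < l) #|[set M in maps W | #|cyclic_points W M| == l]|.
  apply: leq_trans (subset_leq_card sA) _.
  elim/big_rec2: _ => [|l a S _ IH]; first by rewrite cards0.
  by apply: leq_trans (leq_card_setU _ _) _; rewrite leq_add2l.
move=> /leq_trans HA; rewrite [leqLHS]mulnC expnS -mulnA leq_mul2l /= HA //.
apply: leq_trans (_ : \sum_(l < L.+1 | 0 < l) L.+1 * #|W| ^ #|W|.-1 <= _).
  apply: leq_sum => l l0; apply: leq_trans (card_maps_cyclic_points _ l0) _.
  case: l l0 => -[|l] //= lL _; have := @card_forests_bound W l.+1 isT.
  rewrite factS /= mulnCA => /(leq_mul (ltnW lL)); exact.
rewrite sum_nat_const expnS expn1 -mulnA leq_mul2r.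
by rewrite (leq_trans (max_card _)) ?card_ord ?orbT.
Qed.

End RootedForests.

(** * Spanning trees and connected graphs with one cycle *)

Section SpanningSubgraphs.
Import fintype boot.finset.
Local Open Scope nat_scope.
Local Open Scope set_scope.
Variable V : nat.
Notation T := 'I_V.
Implicit Types (W : {set T}) (E : {set {set T}}) (f g M : {ffun T -> T}).
Implicit Types (x y z r : T) (A : graph_on V).

Definition tree_edges W f : {set {set T}} :=
  [set [set x; f x] | x in W :\: roots W f].

Lemma adj_sym A : symmetric (adj A).
Proof. by move=> x y; rewrite /adj setUC. Qed.

Lemma adj_connect_sym A : connect_sym (adj A).
Proof. exact/sym_connect_sym/adj_sym. Qed.

Lemma is_subgraphP W E :
  reflect (W != set0 /\ forall e, e \in E -> #|e| = 2 /\ e \subset W)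
          (is_subgraph (W, E)).
Proof.
apply: (iffP andP) => /= -[W0].
  by move=> /forall_inP H; split=> // e /H /andP[/eqP].
by move=> H; split=> //; apply/forall_inP => e /H [-> ->].
Qed.

Lemma subgraph_adj W E x y : is_subgraph (W, E) -> adj (W, E) x y ->
  [/\ x \in W, y \in W & x != y].
Proof.
move=> /is_subgraphP[_ H] /H[]; rewrite cards2; case: eqVneq => // _ _.
by rewrite subUset !sub1set => /andP[].
Qed.

Lemma is_connectedP W E :
  reflect {in W &, forall x y, connect (adj (W, E)) x y}
          (is_connected (W, E)).
Proof.
apply: (iffP forall_inP) => /= H x.
  by move=> y xW; move/forall_inP: (H x xW); apply.
by move=> xW; apply/forall_inP => y; apply: H.
Qed.

Lemma connect_adjS W E E' x y : E \subset E' ->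
  connect (adj (W, E)) x y -> connect (adj (W, E')) x y.
Proof.
move=> /subsetP sEE'; apply: connect_sub => u v /sEE' Euv; exact: connect1.
Qed.

Lemma tree_edgesP W f e :
  reflect (exists x, [/\ x \in W, f x != x & e = [set x; f x]])
          (e \in tree_edges W f).
Proof.
apply: (iffP imsetP) => -[x].
  rewrite in_setD inE => /andP[+ xW] ->; rewrite xW /= => fx.
  by exists x.
by case=> xW fx ->; exists x; rewrite // in_setD inE xW /= fx.
Qed.

Lemma set2_eq (x y u v : T) : [set x; y] = [set u; v] ->
  (x = u /\ y = v) \/ (x = v /\ y = u).
Proof.
move=> Heq.
have Hx : (x == u) || (x == v) by rewrite -in_set2 -Heq set21.
have Hy : (y == u) || (y == v) by rewrite -in_set2 -Heq set22.
have Hu : (u == x) || (u == y) by rewrite -in_set2 Heq set21.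
have Hv : (v == x) || (v == y) by rewrite -in_set2 Heq set22.
case/orP: Hx => /eqP ?; subst.
  case/orP: Hy => /eqP ?; subst; last by left.
  by case/orP: Hv => /eqP ->; left.
case/orP: Hy => /eqP ?; subst; first by right.
by case/orP: Hu => /eqP ->; left.
Qed.

Lemma forest_no2cycle f x : forest f -> f (f x) = x -> f x = x.
Proof.
move=> ff ffx; apply: forest_periodic => //; rewrite -{2}ffx.
exact: fconnect1.
Qed.

(** Two vertices with the same parent edge would form a cycle of length 2. *)
Lemma card_tree_edges W k f :
  f \in forests W k -> #|tree_edges W f| = #|W| - k.
Proof.
rewrite in_forests => /and3P[_ ff /eqP <-].
rewrite card_in_imset => [|x y].
  rewrite cardsD; suff -> : W :&: roots W f = roots W f by [].
  by apply/setIidPr/subsetP => x; rewrite inE => /andP[].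
rewrite !in_setD ![_ \in roots _ _]inE => /andP[+ xW] /andP[+ yW].
rewrite xW yW /= => fx fy /set2_eq[[]//|[xE yE]].
by case/eqP: fx; apply: forest_no2cycle => //; rewrite yE.
Qed.

Lemma tree_edges_subgraph W f :
  W != set0 -> f \in maps W -> is_subgraph (W, tree_edges W f).
Proof.
move=> W0 /mapsP[f1 _]; apply/is_subgraphP; split=> // e.
move=> /tree_edgesP[x [xW fx ->]]; rewrite cards2 eq_sym fx; split=> //.
by rewrite subUset !sub1set xW f1.
Qed.

Lemma tree_edges_connect W f x : f \in maps W -> x \in W ->
  connect (adj (W, tree_edges W f)) x (endpoint f x).
Proof.
move=> fW xW; rewrite /endpoint; elim: #|T| => [|i IH] //=.
apply: connect_trans IH _; set y := iter i f x.
have yW : y \in W by apply: iter_maps.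
have [-> //|fy] := eqVneq (f y) y.
by apply: connect1; apply/tree_edgesP; exists y.
Qed.

Lemma rooted_tree_endpoint W f r x : f \in forests W 1 -> r \in W -> f r = r ->
  x \in W -> endpoint f x = r.
Proof.
rewrite in_forests => /and3P[fW ff /cards1P[r' Hr]] rW fr xW.
have := endpoint_roots fW ff xW; rewrite Hr => /set1P ->.
by apply/esym/set1P; rewrite -Hr inE rW fr eqxx.
Qed.

Lemma tree_edges_connected W f :
  f \in forests W 1 -> is_connected (W, tree_edges W f).
Proof.
move=> fF; have := fF; rewrite in_forests => /and3P[fW ff _].
apply/is_connectedP => x y xW yW.
apply: connect_trans (tree_edges_connect fW xW) _.
have eW : endpoint f y \in W by apply: iter_maps.
rewrite (rooted_tree_endpoint fF eW (forest_endpoint y ff) xW).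
by rewrite adj_connect_sym tree_edges_connect.
Qed.

(** Grow a tree from [r]. While some vertex is not attached to [r],
    connectedness provides an edge that leaves the attached part; its outer end
    is still a root and can be joined. *)
Lemma spanning_tree W E r : is_subgraph (W, E) -> is_connected (W, E) ->
  r \in W -> exists f, [/\ f \in forests W 1, f r = r & tree_edges W f \subset E].
Proof.
move=> sE /is_connectedP cE rW.
(* Every vertex is either attached to the tree of r or still a root. *)
pose Q f := [/\ f \in maps W, forest f, f r = r, tree_edges W f \subset E &
  forall x, x \in W -> endpoint f x = r \/ f x = x].
pose far f := [set z in W | endpoint f z != r].
have step m f : #|far f| <= m -> Q f ->
  exists f', [/\ f' \in forests W 1, f' r = r & tree_edges W f' \subset E].
  elim: m f => [|m IH] f.
    rewrite leqn0 cards_eq0 => /eqP far0 [fW ff fr fE att]; exists f; split=> //.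
    rewrite in_forests fW ff (_ : roots W f = [set r]) ?cards1 //=.
    apply/setP => x; rewrite in_set1 inE; apply/andP/eqP; last first.
      by move=> ->; rewrite rW fr.
    move=> [xW /eqP fx]; have : x \notin far f by rewrite far0 inE.
    by rewrite inE xW /= negbK /endpoint iter_fix // => /eqP.
  move=> lem Qf; have [far0|[z]] := set_0Vmem (far f).
    by apply: IH Qf; rewrite far0 cards0.
  case: Qf => fW ff fr fE att; rewrite inE => /andP[zW ez].
  have [u [v [uv eu ev]]] : exists u v,
      [/\ adj (W, E) u v, endpoint f u = r & endpoint f v != r].
    have [/existsP[u /existsP[v /and3P[uv /eqP eu ev]]] | H] := boolP
      [exists u, exists v, [&& adj (W, E) u v, endpoint f u == r
                            & endpoint f v != r]]; first by exists u, v.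
    have cl : closed_mem (adj (W, E)) (mem [pred x | endpoint f x == r]).
      move=> x y xy; rewrite !inE.
      have H' p q : adj (W, E) p q -> endpoint f p == r -> endpoint f q == r.
        move=> pq ep; apply/negPn; apply: contra H => eq.
        by apply/existsP; exists p; apply/existsP; exists q; apply/and3P.
      by apply/idP/idP; apply: H' => //; rewrite adj_sym.
    have := closed_connect cl (cE r z rW zW); rewrite !inE (negPf ez).
    by rewrite /endpoint iter_fix ?eqxx.
  have [uW vW uNv] := subgraph_adj sE uv.
  have fv : f v = v by have [e0|//] := att v vW; rewrite e0 eqxx in ev.
  have vNr : v != r.
    by apply: contraNneq ev => ->; rewrite /endpoint iter_fix.
  have euv : endpoint f u != v by rewrite eu eq_sym.
  have ejoin x : endpoint f x = r -> endpoint (upd f v u) x = r.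
    by move=> ex; rewrite endpoint_joinN // ex // eq_sym.
  apply: (IH (upd f v u)).
    rewrite -ltnS; apply: leq_trans lem; apply: proper_card.
    apply/properP; split.
      apply/subsetP => x; rewrite !inE => /andP[-> /=].
      by apply: contra => /eqP/ejoin ->.
    exists v; first by rewrite inE vW ev.
    by rewrite inE vW /= negbK endpoint_join // eu.
  split.
  - exact: maps_upd.
  - exact: forest_join.
  - by rewrite ffunE eq_sym (negPf vNr).
  - apply/subsetP => e /tree_edgesP[x [xW]]; rewrite ffunE.
    have [-> _ ->|_ fx ->] := eqVneq x v; first by rewrite setUC.
    by apply: (subsetP fE); apply/tree_edgesP; exists x.
  - move=> x xW; have [/ejoin|fx] := att x xW; first by left.
    have [->|xv] := eqVneq x v; last by right; rewrite ffunE (negPf xv).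
    by left; rewrite endpoint_join.
pose f0 : {ffun T -> T} := [ffun x => x].
apply: (step #|far f0| f0) => //; split.
- by apply/mapsP; split=> x xW; rewrite ffunE.
- by apply/forestP => x; exists x; rewrite ?connect0 ?ffunE.
- by rewrite ffunE.
- by apply/subsetP => e /tree_edgesP[x [_]]; rewrite ffunE eqxx.
- by right; rewrite ffunE.
Qed.

(** By induction along the path from [x] to the root: the parent edge of [x] in
    the first tree is also one of the second tree. There it is the parent edge
    of [x], because [f x] already has the same parent in both trees. *)
Lemma tree_edges_inj W f g r : f \in forests W 1 -> g \in forests W 1 ->
  r \in W -> f r = r -> g r = r -> tree_edges W f = tree_edges W g -> f = g.
Proof.
move=> fF gF rW fr gr Efg.
have := fF; rewrite in_forests => /and3P[fW ff _].
have := gF; rewrite in_forests => /and3P[gW gf _].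
have [f1 f2] := mapsP _ _ fW; have [_ g2] := mapsP _ _ gW.
apply/ffunP => x; have [xW|xW] := boolP (x \in W); last by rewrite f2 // g2.
have: iter #|T| f x = r by apply: rooted_tree_endpoint fF rW fr xW.
elim: #|T| x xW => [x xW /= ->|i IH x xW]; first by rewrite fr gr.
rewrite iterSr => /(IH _ (f1 _ xW)) gy.
have [fx|fx] := eqVneq (f x) x; first by rewrite fx in gy; rewrite gy.
have : [set x; f x] \in tree_edges W g.
  by rewrite -Efg; apply/tree_edgesP; exists x.
case/tree_edgesP=> w [wW gw /set2_eq[[-> //]|[xE fxE]]].
case/eqP: fx; apply: forest_no2cycle => //.
by rewrite gy fxE -xE.
Qed.

Definition spanning W : {set {set {set T}}} :=
  [set E : {set {set T}} | is_subgraph (W, E) && is_connected (W, E)].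

Lemma spanningP W E :
  reflect (is_subgraph (W, E) /\ is_connected (W, E)) (E \in spanning W).
Proof. by rewrite inE; apply: andP. Qed.

Lemma tree_edges_spanning W f : W != set0 -> f \in forests W 1 ->
  tree_edges W f \in spanning W.
Proof.
move=> W0 fF; apply/spanningP; split; last exact: tree_edges_connected.
by apply: tree_edges_subgraph => //; move: fF; rewrite in_forests => /andP[].
Qed.

Lemma spanning_neq0 W E : E \in spanning W -> exists r, r \in W.
Proof. by move=> /spanningP[/is_subgraphP[/set0Pn]]. Qed.

Lemma spanning_leq_card W E : E \in spanning W -> #|W| <= #|E|.+1.
Proof.
move=> EW; have [r rW] := spanning_neq0 EW; have [sE cE] := spanningP _ _ EW.
have [f [fF _ /subset_leq_card]] := spanning_tree sE cE rW.
by rewrite (card_tree_edges fF) subn1; case: #|W|.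
Qed.

(** Cayley's formula: a spanning tree with a chosen root is the same as a parent
    map with one root. *)
Lemma card_spanning_trees W : 0 < #|W| ->
  #|[set E in spanning W | #|E|.+1 == #|W|]| * #|W| = #|W| ^ #|W|.-1.
Proof.
move=> W0; rewrite -card_rooted_trees // -cardsX.
have [w0 w0W] : exists w, w \in W by apply/set0Pn; rewrite -card_gt0.
have WN0 : W != set0 by rewrite -card_gt0.
pose F f := (tree_edges W f, endpoint f w0).
have rootF f : f \in forests W 1 -> endpoint f w0 \in W /\
    f (endpoint f w0) = endpoint f w0.
  rewrite in_forests => /and3P[fW ff _].
  by rewrite forest_endpoint //; split=> //; apply: iter_maps.
have injF : {in forests W 1 &, injective F}.
  move=> f g fF gF [Efg efg]; have [fW fE] := rootF f fF.
  have [_ gE] := rootF g gF; rewrite -efg in gE.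
  exact: (tree_edges_inj fF gF fW fE gE Efg).
rewrite -(card_in_imset injF); apply: eq_card => -[E r]; apply/idP/imsetP.
  rewrite !in_setX inE => /andP[/andP[EW /eqP cE] rW].
  have [sE coE] := spanningP _ _ EW.
  have [f [fF fr fE]] := spanning_tree sE coE rW; exists f => //.
  rewrite /F (rooted_tree_endpoint fF rW fr w0W); congr pair.
  apply/esym/eqP; rewrite eqEcard fE (card_tree_edges fF) -cE subn1 /=.
  exact: leqnn.
move=> [f fF [-> ->]]; have [fW _] := rootF f fF.
rewrite in_setX fW andbT inE tree_edges_spanning // (card_tree_edges fF).
by rewrite subn1 prednK //=.
Qed.

(** Take any spanning tree, an edge of [E] that it misses, and root the tree
    again at one end of that edge. *)
Lemma spanning_tree_extra W E : E \in spanning W -> #|W| <= #|E| ->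
  exists f x y, [/\ f \in forests W 1, f x = x, x \in W, y \in W & x != y] /\
    [/\ tree_edges W f \subset E, [set x; y] \in E &
        [set x; y] \notin tree_edges W f].
Proof.
move=> EW leWE; have [r rW] := spanning_neq0 EW.
have [sE cE] := spanningP _ _ EW.
have [f [fF fr fE]] := spanning_tree sE cE rW.
have W0 : 0 < #|W| by apply/card_gt0P; exists r.
have [e eE eNf] : exists2 e, e \in E & e \notin tree_edges W f.
  apply/subsetPn; apply: contraL leWE => /subset_leq_card.
  by rewrite (card_tree_edges fF) -ltnNge => h; lia.
have /is_subgraphP[WN0 /(_ e eE)[/eqP/cards2P[x [y [xy exy]]]]] := sE.
rewrite exy subUset !sub1set => /andP[xW yW]; rewrite exy in eE eNf.
have fS := tree_edges_spanning WN0 fF; have [sf cf] := spanningP _ _ fS.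
have [g [gF gx gf]] := spanning_tree sf cf xW.
exists g, x, y; split=> //; split=> //; first exact: fintype.subset_trans fE.
by apply: contra eNf; apply/subsetP.
Qed.

(** Letting the root [x] point to [y] along the extra edge turns the spanning
    tree into a map with one cycle whose edges are those of [E]. *)
Lemma card_spanning_unicyclic W : 0 < #|W| ->
  #|[set E in spanning W | #|E| == #|W|]| <= #|unicyclic_maps W|.
Proof.
move=> W0; apply: leq_trans (leq_imset_card (tree_edges W) _).
apply: subset_leq_card; apply/subsetP => E; rewrite inE => /andP[EW /eqP cE].
have [|f [x [y [[fF fx xW yW xy] [fE xyE xyN]]]]] := spanning_tree_extra EW.
  by rewrite cE.
have := fF; rewrite in_forests => /and3P[fW ff _].
apply/imsetP; exists (upd f x y).
  rewrite inE maps_upd //=; apply/set0Pn; exists x; apply/cyclic_pointsP; split=> //.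
  move=> z zW; apply: connect_upd; rewrite endpoint_connect //.
  by rewrite (rooted_tree_endpoint fF xW fx zW).
have tE : tree_edges W (upd f x y) = [set x; y] |: tree_edges W f.
  apply/setP => e; apply/tree_edgesP/setU1P.
    move=> [z [zW]]; rewrite ffunE.
    have [-> _ ->|_ fz ->] := eqVneq z x; first by left.
    by right; apply/tree_edgesP; exists z.
  move=> [->|/tree_edgesP[z [zW fz ->]]].
    by exists x; rewrite ffunE eqxx eq_sym.
  exists z; rewrite ffunE; have [zx|//] := eqVneq z x.
  by rewrite zx fx eqxx in fz.
rewrite tE; apply/esym/eqP; rewrite eqEcard subUset sub1set xyE fE /=.
by rewrite cardsU1 xyN (card_tree_edges fF) cE; lia.
Qed.

(** An edge outside a spanning tree closes a cycle. Conversely an edge of a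
    cycle can be removed without disconnecting the graph, and a connected graph
    has at least [#|W| - 1] edges. *)
Lemma acyclic_card W E : E \in spanning W ->
  is_acyclic (W, E) = (#|E|.+1 == #|W|).
Proof.
move=> EW; have [sE cE] := spanningP _ _ EW; apply/asboolP/idP; last first.
  move=> /eqP cEW [|x [|y [|z p]]] //= _; apply/negP => /andP[/=].
  move=> /and3P[xy yz pz] /and3P[xN yN _].
  (* The rest of the cycle connects x and y without the edge xy. *)
  pose E' := E :\ [set x; y].
  have aE' u v : adj (W, E) u v -> [set u; v] != [set x; y] -> adj (W, E') u v.
    by move=> uv nuv; rewrite /adj in_setD1 nuv.
  have yx : connect (adj (W, E')) y x.
    apply/connectP; exists (z :: rcons p x); last by rewrite /= last_rcons.
    rewrite rcons_path /= in pz; case/andP: pz => pz zx.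
    have ne u v : v != x -> u != x -> [set u; v] != [set x; y].
      move=> vx ux; apply/eqP => /set2_eq[[ux' _]|[_ vx']].
        by rewrite ux' eqxx in ux.
      by rewrite vx' eqxx in vx.
    move: xN; rewrite !inE !negb_or eq_sym => /and3P[yNx zNx xNp].
    rewrite /= rcons_path aE' //=; last by apply: ne; rewrite // eq_sym.
    apply/andP; split; last first.
      apply: aE' => //; apply/eqP => /set2_eq[[_ xy'] | [lE _]].
        by rewrite xy' eqxx in yNx.
      by move: yN; rewrite -lE -[z :: p]/(z :: p) mem_last.
    have : all [pred u | u != x] (z :: p).
      by apply/allP => u /=; rewrite inE => /predU1P[->|up];
        rewrite ?(eq_sym z) //; apply: contraNneq xNp => <-.
    have sub : {in [pred u | u != x] &, subrel (adj (W, E)) (adj (W, E'))}.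
      by move=> u v; rewrite !inE => ux vx uv; apply: aE' => //; apply: ne.
    by move=> /(sub_in_path sub); apply.
  have : E' \in spanning W.
    apply/spanningP; split.
      apply/is_subgraphP; have /is_subgraphP[W0 H] := sE; split=> // e.
      by rewrite in_setD1 => /andP[_ /H].
    apply/is_connectedP => u v uW vW; have /is_connectedP cE1 := cE.
    apply: connect_sub (cE1 u v uW vW) => a b ab.
    have [/set2_eq[[-> ->]|[-> ->]]|nab] := eqVneq [set a; b] [set x; y] => //.
      by rewrite adj_connect_sym.
    by apply: connect1; apply: aE'.
  move=> /spanning_leq_card; rewrite -cEW /E'.
  by rewrite (cardsD1 [set x; y] E) [_ \in E]xy ltnn.
move=> acyc; rewrite eqn_leq (spanning_leq_card EW) andbT ltnNge.
apply/negP => /(spanning_tree_extra EW)[f [x [y [[fF fx xW yW xy] [fE xyE xyN]]]]].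
have /is_connectedP cf := tree_edges_connected fF.
have /connectP[p0 pp0] := cf y x yW xW.
case/shortenP: pp0 => p pp up _ xlast.
have ucyc : ucycleb (adj (W, E)) (y :: p).
  rewrite /ucycleb up andbT /= rcons_path -xlast [adj _ _ _]xyE andbT.
  by apply: sub_path pp => u v; apply: (subsetP fE).
have size_p : 2 < size (y :: p).
  case: p pp up xlast {ucyc} => [|u [|v p]] //= pp _ xlast.
    by rewrite xlast eqxx in xy.
  by move: pp xyN; rewrite xlast setUC andbT /adj /= => ->.
by have := acyc _ size_p; rewrite ucyc.
Qed.

Lemma in_trees W E :
  ((W, E) \in trees V) = (E \in spanning W) && (#|E|.+1 == #|W|).
Proof.
have [EW|EW] := boolP (E \in spanning W).
  have [sE cE] := spanningP _ _ EW.
  by rewrite inE sE cE acyclic_card.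
by apply: contraNF EW; rewrite inE => /and3P[? ? _]; apply/spanningP.
Qed.

Lemma in_connected W E : ((W, E) \in connected_subgraphs V) = (E \in spanning W).
Proof. by rewrite !inE. Qed.

End SpanningSubgraphs.

(** * Sums over subsets and over vertex sets *)

Section SumsOverSubsets.
Import fintype boot.finset.
Local Open Scope set_scope.
Variables (R : pzSemiRingType) (T : finType).
Implicit Types (P X D : {set T}) (phi : nat -> R).

Lemma sum_subsets_card P phi :
  \sum_(D : {set T} | D \subset P) phi #|D| =
  \sum_(j < #|P|.+1) phi j *+ 'C(#|P|, j).
Proof.
rewrite (partition_big (fun D : {set T} => inord #|D| : 'I_#|P|.+1) xpredT) //=.
apply: eq_bigr => j _; rewrite -(cards_draws P j).
rewrite -[#|[set _ | _ & _]|]sum1_card -sumrMnr.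
have eP (D : {set T}) : (D \subset P) && (inord #|D| == j :> 'I_#|P|.+1) =
    (D \in [set A : {set T} | A \subset P & #|A| == j]).
  rewrite inE; apply: andb_id2l => /subset_leq_card DP.
  by apply/eqP/eqP => [<-|Dj]; [|apply: val_inj]; rewrite /= inordK.
rewrite (eq_bigl _ _ eP); apply: eq_bigr => D.
by rewrite inE mulr1n => /andP[_ /eqP ->].
Qed.

Lemma sum_supersets_card X phi :
  \sum_(W : {set T} | X \subset W) phi #|W| =
  \sum_(j < (#|T| - #|X|).+1) phi (#|X| + j)%N *+ 'C(#|T| - #|X|, j).
Proof.
rewrite -cardsT -(setIidPr (subsetT X)) -cardsD setTI setTD.
rewrite -(sum_subsets_card (~: X) (fun j => phi (#|X| + j)%N)).
rewrite (reindex_onto (fun D => X :|: D) (fun W => W :\: X)) /=; last first.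
  by move=> W XW; rewrite setUC setDE setUIl setUC (setUC (~: X)) setUCr setIT;
     apply/setUidPr.
have eD D : (X \subset X :|: D) && ((X :|: D) :\: X == D) = (D \subset ~: X).
  rewrite subsetUl /= setDUl setDv set0U setDE; apply/eqP/idP => [<-|].
    by rewrite subsetIr.
  by move/setIidPl.
rewrite (eq_bigl _ _ eD); apply: eq_bigr => D DX; congr (phi _).
rewrite cardsU (_ : X :&: D = set0) ?cards0 ?subn0 //.
apply/eqP; rewrite -subset0; apply/subsetP => x; rewrite inE => /andP[xX].
by move/(subsetP DX); rewrite inE xX.
Qed.

End SumsOverSubsets.

Section SpanningSums.
Import fintype boot.finset.
Local Open Scope set_scope.
Variables (R : realType) (V : nat).
Implicit Types (W : {set 'I_V}) (E : {set {set 'I_V}}) (z : R).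

(** For [L + 1] of order [n^(1/4)] both terms of [card_unicyclic_maps] are
    [O(n^(n - 1/4))] after division by [L + 1]. *)
Lemma card_unicyclic_le W : (0 < #|W|)%N ->
  #|[set E in spanning W | #|E| == #|W|]|%:R <=
  5 * #|W|%:R ^+ #|W| / Num.sqrt (Num.sqrt #|W|%:R) :> R.
Proof.
move=> W0; set n := #|W|; set c1 := #|_|.
set q : R := Num.sqrt (Num.sqrt n%:R).
have n1 : 1 <= n%:R :> R by rewrite ler1n.
have n0 : 0 < n%:R :> R by rewrite ltr0n.
have q1 : 1 <= q by rewrite -[1]sqrtr1 -[X in Num.sqrt X]sqrtr1 !ler_wsqrtr.
have q0 : 0 < q by apply: lt_le_trans q1.
have q4 : q ^+ 4 = n%:R.
  by rewrite (exprM q 2 2) /q !sqr_sqrtr ?sqrtr_ge0 ?ler0n.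
pose k := (Num.truncn q).+1.
have [kl kr] : q <= k%:R /\ k%:R <= 2 * q.
  have /andP[h1 h2] := truncn_itv (ltW q0); split; first exact: ltW.
  by rewrite /k -natr1; lra.
have k0 : 0 < k%:R :> R by apply: lt_le_trans kl.
have : (c1 * k <= k ^ 3 * n ^ n.-1 + n ^ n)%N.
  apply: leq_trans (card_unicyclic_maps (Num.truncn q) W0).
  by rewrite leq_mul2r card_spanning_unicyclic ?orbT.
rewrite -(ler_nat R) natrD !natrM !natrX => H.
have Hn : n%:R ^+ n = n%:R * n%:R ^+ n.-1 :> R by rewrite -exprS prednK.
set a : R := n%:R ^+ n.-1 in H Hn *.
have a0 : 0 <= a by rewrite exprn_ge0 // ltW.
rewrite Hn in H *; rewrite -q4 in H *; rewrite ler_pdivlMr //.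
set c : R := c1%:R in H *; set K : R := k%:R in H kl kr k0 *.
have c0 : 0 <= c by rewrite ler0n.
have H1 : c * K <= (4 * q ^+ 2 * K + q ^+ 4) * a.
  apply: (le_trans H); rewrite mulrDl lerD2r ler_wpM2r //.
  rewrite mulrA ler_wpM2r ?(ltW k0) // -expr2.
  have -> : 4 * q ^+ 2 = (2 * q) ^+ 2 by ring.
  by rewrite ler_sqr // nnegrE ltW // mulr_gt0.
have H2 : c * K <= (4 * q ^+ 2 * K + q ^+ 3 * K) * a.
  apply: (le_trans H1); rewrite ler_wpM2r // lerD2l exprSr.
  by rewrite ler_wpM2l // exprn_ge0 // ltW.
have H3 : c <= (4 * q ^+ 2 + q ^+ 3) * a.
  by rewrite -(ler_pM2r k0) (le_trans H2) // le_eqVlt; apply/orP; left; apply/eqP; ring.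
have H4 : c <= 5 * q ^+ 3 * a.
  apply: (le_trans H3); rewrite ler_wpM2r //.
  have : q ^+ 2 <= q ^+ 3 by rewrite ler_weXn2l.
  lra.
apply: le_trans (_ : 5 * q ^+ 3 * a * q <= _); first by rewrite ler_pM2r.
by rewrite le_eqVlt; apply/orP; left; apply/eqP; ring.
Qed.

(** The quotient equals [n^(n-2)], and also makes sense for [n = 1]. *)
Definition tree_weight n z : R := n%:R ^+ n / n%:R ^+ 2 * z ^+ n.-1.

(** Bound for the ratio between the weight of the connected graphs other than
    trees and the weight of the trees on [n] vertices. *)
Definition excess_bound n z : R :=
  5 * n%:R ^+ 2 * z * (1 + z) ^+ 'C(n, 2) / Num.sqrt (Num.sqrt n%:R).

Lemma card_spanning_trees_real W : (0 < #|W|)%N ->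
  #|[set E in spanning W | #|E|.+1 == #|W|]|%:R =
  #|W|%:R ^+ #|W| / #|W|%:R ^+ 2 :> R.
Proof.
move=> W0; have n0 : #|W|%:R != 0 :> R by rewrite pnatr_eq0 -lt0n.
have := congr1 (fun k => k%:R : R) (card_spanning_trees W0).
rewrite natrM natrX => H; apply: (mulIf n0); rewrite H.
apply: (mulfI n0); rewrite -exprS prednK //.
by field.
Qed.

Lemma sum_spanning_trees W z : (0 < #|W|)%N ->
  \sum_(E in spanning W | #|E|.+1 == #|W|) z ^+ #|E| = tree_weight #|W| z.
Proof.
move=> W0; rewrite /tree_weight -card_spanning_trees_real // mulr_natl.
rewrite -sumr_const; apply: eq_big => E; first by rewrite inE.
by move=> /andP[_ /eqP <-].
Qed.

Lemma sum_spanning_ge W z : (0 < #|W|)%N -> 0 <= z ->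
  tree_weight #|W| z <= \sum_(E in spanning W) z ^+ #|E|.
Proof.
move=> W0 z0; rewrite -sum_spanning_trees //.
rewrite [leRHS](bigID (fun E => #|E|.+1 == #|W|)) /= lerDl.
by apply: sumr_ge0 => E _; rewrite exprn_ge0.
Qed.

(** A connected graph with at least [#|W|] edges is the union of a connected
    graph with [#|W|] edges and of a disjoint set of edges; dropping the
    constraints on the latter set gives the factor [(1 + z)^('C(n, 2))]. *)
Lemma sum_spanning_le W z : (0 < #|W|)%N -> 0 <= z ->
  \sum_(E in spanning W) z ^+ #|E| <=
  tree_weight #|W| z * (1 + excess_bound #|W| z).
Proof.
move=> W0 z0; rewrite mulrDr mulr1 -sum_spanning_trees //.
rewrite [leLHS](bigID (fun E => #|E|.+1 == #|W|)) /= lerD2l.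
pose P : {set {set 'I_V}} := [set e : {set 'I_V} | e \subset W & #|e| == 2].
pose C1 := [set E in spanning W | #|E| == #|W|].
pose X := setX C1 (powerset P).
pose F (p : {set {set 'I_V}} * {set {set 'I_V}}) := p.1 :|: p.2.
have cover E : (E \in spanning W) && (#|E|.+1 != #|W|) ->
    exists2 p, p \in X & F p = E /\ #|E| = (#|p.1| + #|p.2|)%N.
  move=> /andP[EW nE].
  have leWE : (#|W| <= #|E|)%N.
    by have := spanning_leq_card EW; rewrite leq_eqVlt eq_sym (negPf nE).
  have [f [x [y [[fF fx xW yW xy] [fE xyE xyN]]]]] := spanning_tree_extra EW leWE.
  have [/is_subgraphP[WN0 sE] _] := spanningP _ _ EW.
  pose E1 := [set x; y] |: tree_edges W f.
  have E1E : E1 \subset E by rewrite subUset sub1set xyE fE.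
  exists (E1, E :\: E1); last first.
    rewrite /F /=; split.
      by rewrite -[RHS](setID E E1) (setIidPr E1E).
    by rewrite -(cardsID E1 E) (setIidPr E1E).
  have [sf cf] := spanningP _ _ (tree_edges_spanning WN0 fF).
  rewrite in_setX inE /= cardsU1 xyN (card_tree_edges fF) powersetE.
  rewrite subn1 add1n prednK // eqxx andbT; apply/andP; split.
    apply/spanningP; split.
      by apply/is_subgraphP; split=> // e /(subsetP E1E)/sE.
    apply/is_connectedP => u v uW vW; have /is_connectedP cf' := cf.
    by apply: (connect_adjS _ (cf' u v uW vW)); apply: subsetUr.
  by apply/subsetP => e /setDP[/sE[e2 eW] _]; rewrite inE eW e2.
apply: le_trans (_ : \sum_(p in X) z ^+ (#|p.1| + #|p.2|) <= _).
  rewrite [leRHS](bigID (fun p => (F p \in spanning W) && (#|F p|.+1 != #|W|))) /=.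
  rewrite -[leLHS]addr0 lerD //; last first.
    by apply: sumr_ge0 => p _; rewrite exprn_ge0.
  rewrite (partition_big F (fun E => (E \in spanning W) && (#|E|.+1 != #|W|))) /=;
    last by move=> p /andP[].
  apply: ler_sum => E EP; have [p pX [Fp cE]] := cover E EP.
  rewrite (bigD1 p) /=; last by rewrite pX Fp EP eqxx.
  rewrite cE lerDl; apply: sumr_ge0 => q _; exact: exprn_ge0.
rewrite (eq_bigl (fun p => (p.1 \in C1) && (p.2 \in powerset P))); last first.
  by move=> [a b]; rewrite in_setX.
rewrite -(pair_big (fun a => a \in C1) (fun b => b \in powerset P)
   (fun a b : {set {set 'I_V}} => z ^+ (#|a| + #|b|))) /=.
have -> : \sum_(a in C1) \sum_(b in powerset P) z ^+ (#|a| + #|b|) =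
    #|C1|%:R * (z ^+ #|W| * (1 + z) ^+ 'C(#|W|, 2)).
  rewrite mulr_natl -sumr_const; apply: eq_bigr => a; rewrite inE => /andP[_ /eqP ->].
  under eq_bigr do rewrite exprD.
  rewrite -mulr_sumr; congr (_ * _).
  under eq_bigl do rewrite powersetE.
  rewrite (sum_subsets_card P (fun k => z ^+ k)) cards_draws exprDn.
  by apply: eq_bigr => i _; rewrite expr1n mul1r.
rewrite sum_spanning_trees // /tree_weight /excess_bound.
have n0 : #|W|%:R != 0 :> R by rewrite pnatr_eq0 -lt0n.
apply: le_trans (ler_wpM2r _ (card_unicyclic_le W0)) _.
  by rewrite mulr_ge0 // exprn_ge0 // addr_ge0.
rewrite -[X in z ^+ X * _](prednK W0) exprS.
have s0 : Num.sqrt (Num.sqrt #|W|%:R) != 0 :> R.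
  by rewrite gt_eqF // !sqrtr_gt0 ltr0n.
by rewrite le_eqVlt; apply/orP; left; apply/eqP; field; rewrite n0 s0.
Qed.

End SpanningSums.

Section PointFunctions.
Import fintype boot.finset.
Local Open Scope set_scope.
Variables (R : realType) (N : nat).
Notation V := N.+2.
Implicit Types (F : forall V : nat, {set graph_on V}) (p z : R) (h : nat -> R).

(** Here [m] counts the vertices other than 0 and 1, and [h m] is a correction to
    the weight of the trees. *)
Definition two_point_sum z h : R :=
  \sum_(m < N.+1) ('C(N, m)%:R * tree_weight m.+2 z) * h m.

Definition graph_weight F p (W : {set 'I_V}) : R :=
  \sum_(E : {set {set 'I_V}} | (W, E) \in F V) (p / (expR 1 * V%:R)) ^+ #|E|.

Lemma sum_graphs F p (P : pred {set 'I_V}) :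
  \sum_(A in F V | P A.1) weight p A = \sum_(W | P W) graph_weight F p W.
Proof.
rewrite pair_big_dep /=; apply: eq_bigl => -[W E] /=; exact: andbC.
Qed.

Lemma two_point_supersets F p : two_point F V p =
  \sum_(W : {set 'I_V} | [set ord0; lift ord0 ord0] \subset W) graph_weight F p W.
Proof.
rewrite -(sum_graphs F p (fun W => _ \subset W)).
apply: eq_bigl => -[W E]; congr (_ && _); rewrite subUset !sub1set /contains /=.
congr (_ && _); apply/exists_inP/idP => [[x xW /eqP x0]|xW].
- by rewrite (_ : ord0 = x) //; apply: val_inj.
- by exists ord0.
- by rewrite (_ : lift _ _ = x) //; apply: val_inj.
- by exists (lift ord0 ord0).
Qed.

Lemma one_point_supersets F p : one_point F V p =
  \sum_(W : {set 'I_V} | [set ord0] \subset W) graph_weight F p W.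
Proof.
rewrite -(sum_graphs F p (fun W => _ \subset W)).
apply: eq_bigl => -[W E]; congr (_ && _); rewrite sub1set /contains /=.
apply/exists_inP/idP => [[x xW /eqP x0]|xW]; last by exists ord0.
by rewrite (_ : ord0 = x) //; apply: val_inj.
Qed.

Lemma excess_bound_ge0 n z : 0 <= z -> 0 <= excess_bound n z.
Proof.
move=> z0; rewrite /excess_bound divr_ge0 ?sqrtr_ge0 // !mulr_ge0 ?ler0n //.
by rewrite exprn_ge0 // addr_ge0.
Qed.

Lemma tree_weight_ge0 n z : 0 <= z -> 0 <= tree_weight n z.
Proof.
by move=> z0; rewrite /tree_weight mulr_ge0 ?divr_ge0 ?exprn_ge0 ?ler0n.
Qed.

Definition trees_or_connected F :=
  F = trees \/ F = connected_subgraphs.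

Lemma graph_weight_bounds F p (W : {set 'I_V}) :
  trees_or_connected F -> 0 <= p -> (0 < #|W|)%N ->
  let z := p / (expR 1 * V%:R) in
  is_true (tree_weight #|W| z <= graph_weight F p W <=
    tree_weight #|W| z * (1 + excess_bound #|W| z)).
Proof.
move=> FE p0 W0 z; have z0 : 0 <= z.
  by rewrite /z divr_ge0 // mulr_ge0 ?expR_ge0 ?ler0n.
case: FE => ->; rewrite /graph_weight -/z.
  under eq_bigl do rewrite in_trees.
  rewrite sum_spanning_trees // lexx /= mulrDr mulr1 lerDl.
  by rewrite mulr_ge0 ?tree_weight_ge0 ?excess_bound_ge0.
under eq_bigl do rewrite in_connected.
by rewrite sum_spanning_ge ?sum_spanning_le.
Qed.

Lemma two_point_bounds F p : trees_or_connected F -> 0 <= p ->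
  let z := p / (expR 1 * V%:R) in
  is_true (two_point_sum z (fun=> 1) <= two_point F V p <=
    two_point_sum z (fun m => 1 + excess_bound m.+2 z)).
Proof.
move=> FE p0 z; rewrite two_point_supersets.
have card2 : #|[set ord0; lift ord0 ord0] : {set 'I_V}| = 2 by rewrite cards2.
have sumE (phi : nat -> R) :
    \sum_(W : {set 'I_V} | [set ord0; lift ord0 ord0] \subset W) phi #|W| =
    \sum_(m < N.+1) 'C(N, m)%:R * phi m.+2.
  rewrite sum_supersets_card card2 card_ord subn2 /=.
  by apply: eq_bigr => j _; rewrite mulr_natl.
have pos (W : {set 'I_V}) : [set ord0; lift ord0 ord0] \subset W -> (0 < #|W|)%N.
  by move=> /subset_leq_card; rewrite card2; apply: leq_trans.
apply/andP; split.
  have -> : two_point_sum z (fun=> 1) =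
      \sum_(W : {set 'I_V} | [set ord0; lift ord0 ord0] \subset W) tree_weight #|W| z.
    by rewrite (sumE (fun n => tree_weight n z)); apply: eq_bigr => j _; rewrite mulr1.
  by apply: ler_sum => W /pos W0; case/andP: (graph_weight_bounds FE p0 W0).
have -> : two_point_sum z (fun m => 1 + excess_bound m.+2 z) =
    \sum_(W : {set 'I_V} | [set ord0; lift ord0 ord0] \subset W)
      tree_weight #|W| z * (1 + excess_bound #|W| z).
  rewrite (sumE (fun n => tree_weight n z * (1 + excess_bound n z))).
  by apply: eq_bigr => j _; rewrite mulrA.
by apply: ler_sum => W /pos W0; case/andP: (graph_weight_bounds FE p0 W0).
Qed.

(** There are ['C(N + 1, m + 1) = (N + 1) / (m + 1) * 'C(N, m)] vertex sets of
    size [m + 2] that contain 0; the single vertex is the leading summand. *)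
Lemma one_point_bounds F p : trees_or_connected F -> 0 <= p ->
  let z := p / (expR 1 * V%:R) in
  is_true (0 <= one_point F V p <= 1 + excess_bound 1 z +
    N.+1%:R * two_point_sum z (fun m => (1 + excess_bound m.+2 z) / m.+1%:R)).
Proof.
move=> FE p0 z; have z0 : 0 <= z.
  by rewrite /z divr_ge0 // mulr_ge0 ?expR_ge0 ?ler0n.
rewrite one_point_supersets.
have pos (W : {set 'I_V}) : [set ord0] \subset W -> (0 < #|W|)%N.
  by move=> /subset_leq_card; rewrite cards1; apply: leq_trans.
apply/andP; split.
  apply: sumr_ge0 => W /pos W0; case/andP: (graph_weight_bounds FE p0 W0) => + _.
  by apply: le_trans; apply: tree_weight_ge0.
apply: le_trans (_ : \sum_(W : {set 'I_V} | [set ord0] \subset W)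
      tree_weight #|W| z * (1 + excess_bound #|W| z) <= _).
  by apply: ler_sum => W /pos W0; case/andP: (graph_weight_bounds FE p0 W0).
rewrite (sum_supersets_card _ (fun n => tree_weight n z * (1 + excess_bound n z))).
rewrite cards1 card_ord subn1 /= big_ord_recl /= bin0 mulr1n addn0.
have -> : tree_weight 1 z = 1 by rewrite /tree_weight !expr1n divr1 expr0 mulr1.
rewrite mul1r lerD2l.
rewrite le_eqVlt; apply/orP; left; apply/eqP.
rewrite /two_point_sum mulr_sumr; apply: eq_bigr => m _.
rewrite -mulr_natl /bump /= add1n.
have := congr1 (fun k => k%:R : R) (mul_bin_diag N.+1 m); rewrite /= !natrM => H.
have m0 : m.+1%:R != 0 :> R by rewrite pnatr_eq0.
have -> : 'C(N.+1, m.+1)%:R = N.+1%:R * 'C(N, m)%:R / m.+1%:R :> R.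
  by rewrite H mulrAC divff ?mul1r.
by rewrite add1n; field.
Qed.

End PointFunctions.

(** * Stirling's formula *)

Section Wallis.
Local Open Scope classical_set_scope.
Variable R : realType.
Notation mu := (@lebesgue_measure R).

Definition wallis n : R := \int[mu]_(x in `[0, pi / 2]) cos x ^+ n.

Let pihalf_gt0 : 0 < pi / 2 :> R.
Proof. by rewrite divr_gt0 ?pi_gt0. Qed.

Lemma cosX_continuous n : continuous (fun x : R => cos x ^+ n).
Proof.
move=> x; apply: (@continuous_comp _ _ _ cos (fun y : R => y ^+ n)).
  exact: continuous_cos.
exact: exprn_continuous.
Qed.

Lemma continuous_integrable (f : R -> R) a b :
  continuous f -> mu.-integrable `[a, b] (EFin \o f).
Proof.
move=> cf; apply: continuous_compact_integrable; first exact: segment_compact.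
exact: continuous_subspaceT.
Qed.

Lemma cosX_integrable n :
  mu.-integrable `[0, pi / 2] (EFin \o (fun x : R => cos x ^+ n)).
Proof. by apply: continuous_integrable; apply: cosX_continuous. Qed.

(** [n.+2 cos^n.+2 - n.+1 cos^n] is the derivative of [cos^n.+1 sin], which
    vanishes at both ends of the interval. *)
Lemma wallis_rec n : n.+2%:R * wallis n.+2 = n.+1%:R * wallis n.
Proof.
pose f x : R := n.+2%:R * cos x ^+ n.+2 - n.+1%:R * cos x ^+ n.
pose F x : R := cos x ^+ n.+1 * sin x.
have dF (x : R) : is_derive x 1 F (f x).
  have -> : F = (@cos R ^+ n.+1) * @sin R.
    by apply/funext => y; rewrite /F mulrfctE exprfctE.
  apply: is_derive_eq; rewrite exprfctE /f /GRing.scale /=.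
  rewrite -[n.+2%:R]natr1.
  have := cos2Dsin2 x; move: (cos x) (sin x) => c s.
  move=> H; have -> : c ^+ n.+2 = c ^+ n * c ^+ 2 by rewrite -exprD addn2.
  have -> : c ^+ n.+1 = c ^+ n * c by rewrite exprSr.
  move: (c ^+ n) => d.
  have Hs : s * s = 1 - c ^+ 2 by rewrite -H; ring.
  transitivity (d * c ^+ 2 - n.+1%:R * d * (s * s)); first by ring.
  by rewrite Hs; ring.
have cf : continuous f.
  move=> x; apply: cvgB; (apply: cvgM; [exact: cvg_cst|exact: cosX_continuous]).
have cF : continuous F.
  by move=> x; apply: cvgM; [apply: cosX_continuous | apply: continuous_sin].
have : \int[mu]_(x in `[0, pi / 2]) f x = 0.
  rewrite /Rintegral (@continuous_FTC2 _ f F) //.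
  - by rewrite /F cos_pihalf sin0 expr0n /= !(mul0r, mulr0) subrr.
  - exact: continuous_subspaceT.
  - split.
    + by move=> x _; exact: ex_derive.
    + by apply: cvg_at_right_filter; apply: cF.
    + by apply: cvg_at_left_filter; apply: cF.
  - by move=> x _; rewrite derive1E; exact: derive_val.
rewrite /f RintegralB //; last 2 first.
- by apply: continuous_integrable => x; apply: cvgM;
    [exact: cvg_cst|exact: cosX_continuous].
- by apply: continuous_integrable => x; apply: cvgM;
    [exact: cvg_cst|exact: cosX_continuous].
rewrite !RintegralZl //; try exact: cosX_integrable.
by move/eqP; rewrite subr_eq0 => /eqP.
Qed.

Lemma wallis0 : wallis 0 = pi / 2.
Proof.
rewrite /wallis (eq_Rintegral _ (g := fun=> 1)); last by move=> x _; rewrite expr0.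
rewrite Rintegral_cst // mul1r.
by rewrite /= lebesgue_measure_itv /= lte_fin pihalf_gt0 -EFinD subr0.
Qed.

Lemma wallis1 : wallis 1 = 1.
Proof.
rewrite /wallis /Rintegral (@continuous_FTC2 _ _ sin) //.
- by rewrite sin_pihalf sin0 /= subr0.
- by apply: continuous_subspaceT; apply: cosX_continuous.
- split.
  + by move=> x _; exact: ex_derive.
  + by apply: cvg_at_right_filter; apply: continuous_sin.
  + by apply: cvg_at_left_filter; apply: continuous_sin.
- by move=> x _; rewrite derive1E expr1; exact: derive_val.
Qed.

Lemma wallis_decr n : wallis n.+1 <= wallis n.
Proof.
apply: le_Rintegral => //; try exact: cosX_integrable.
move=> x; rewrite /= in_itv /= => /andP[x0 xp].
have c0 : 0 <= cos x.
  by apply: cos_ge0_pihalf; rewrite xp andbT (le_trans _ x0) // oppr_le0 ltW.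
by rewrite exprS ler_piMl ?exprn_ge0 ?cos_le1.
Qed.

Lemma wallis_mul n : n.+1%:R * (wallis n * wallis n.+1) = pi / 2.
Proof.
elim: n => [|n IH]; first by rewrite wallis0 wallis1 mulr1 mul1r.
by rewrite -IH mulrCA wallis_rec; ring.
Qed.

(** The central binomial coefficient divided by [4^n]. *)
Definition central_ratio n : R := (n.*2)`!%:R / (n`!%:R ^+ 2 * 4 ^+ n).

Lemma central_ratioS n : central_ratio n.+1 = central_ratio n * (n.*2.+1%:R / n.*2.+2%:R).
Proof.
have e1 : n.+1%:R = n%:R + 1 :> R by rewrite natr1.
have e2 : n.*2.+1%:R = n%:R * 2 + 1 :> R by rewrite -natrM natr1 muln2.
have e3 : n.*2.+2%:R = n%:R * 2 + 2 :> R by rewrite -natrM -natrD muln2 addn2.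
rewrite /central_ratio doubleS !factS !natrM e1 e2 e3 [4 ^+ n.+1]exprS.
have f0 : n`!%:R != 0 :> R by rewrite pnatr_eq0 -lt0n fact_gt0.
have h0 : n%:R + 1 != 0 :> R by rewrite natr1 pnatr_eq0.
have h1 : n%:R * 2 + 2 != 0 :> R by rewrite -e3 pnatr_eq0.
have h4 : 4 ^+ n != 0 :> R by rewrite expf_neq0 // pnatr_eq0.
move: (n`!%:R) (n.*2`!%:R) (4 ^+ n) f0 h4 => a b c a0 c0.
by field; rewrite a0 h0 h1 c0.
Qed.

Lemma wallis_central_ratio n : wallis n.*2 = pi / 2 * central_ratio n.
Proof.
elim: n => [|n IH].
  by rewrite wallis0 /central_ratio /= fact0 expr1n expr0 mulr1 divr1 mulr1.
rewrite central_ratioS mulrA -IH doubleS.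
have h : n.*2.+2%:R != 0 :> R by rewrite pnatr_eq0.
by apply: (mulfI h); rewrite wallis_rec; field.
Qed.

(** The Wallis integrals decrease and the product of two consecutive ones is
    known, which encloses their squares. *)
Lemma central_ratio_bounds n :
  n.*2%:R * central_ratio n ^+ 2 <= 2 / pi <= n.*2.+1%:R * central_ratio n ^+ 2.
Proof.
have p0 := pi_gt0 R; have q0 : 0 <= pi / 2 :> R by apply: ltW.
have w0 k : 0 <= wallis k.
  apply: Rintegral_ge0 => x; rewrite /= in_itv /= => /andP[x0 xp].
  apply: exprn_ge0; apply: cos_ge0_pihalf.
  by rewrite xp andbT (le_trans _ x0) // oppr_le0.
have E : central_ratio n = wallis n.*2 * (2 / pi).
  rewrite wallis_central_ratio; move: (pi : R) (central_ratio n) p0 => P c P0.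
  by field; rewrite gt_eqF.
have E2 : 2 / pi = (pi / 2) * (2 / pi) ^+ 2 :> R.
  by move: (pi : R) p0 => P P0; field; rewrite gt_eqF.
have H1 : n.*2%:R * wallis n.*2 ^+ 2 <= pi / 2.
  case: n {E} => [|n]; first by rewrite mul0r.
  rewrite -(wallis_mul n.*2.+1) -doubleS expr2 ler_wpM2l // ler_wpM2r //.
  exact: wallis_decr.
have H2 : pi / 2 <= n.*2.+1%:R * wallis n.*2 ^+ 2.
  by rewrite -(wallis_mul n.*2) ler_wpM2l // expr2 ler_wpM2l // wallis_decr.
have k0 : 0 <= (2 / pi) ^+ 2 :> R by rewrite exprn_ge0 // divr_ge0 // ltW.
rewrite E exprMn [X in _ <= X <= _]E2; set k := (2 / pi) ^+ 2 in k0 *.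
by rewrite !(mulrA _ _ k) !ler_wpM2r.
Qed.

End Wallis.

Section Stirling.
Local Open Scope classical_set_scope.
Variable R : realType.
Implicit Types (t x : R).

Lemma is_derive_conv (f g : R -> R) x a b :
  f =1 g -> a = b -> is_derive x 1 f a -> is_derive x 1 g b.
Proof. by move=> /funext -> ->. Qed.

Lemma ge0_of_derive (F dF : R -> R) :
  (forall x, 0 <= x -> is_derive x 1 F (dF x)) ->
  (forall x, 0 <= x -> 0 <= dF x) -> F 0 = 0 -> forall t, 0 <= t -> 0 <= F t.
Proof.
move=> F' dF0 F0 t t0; rewrite -F0.
apply: (@ger0_derive1_ndecry _ F 0) => //.
- move=> x; rewrite in_itv /= andbT => /ltW/F' dx; exact: ex_derive.
- move=> x; rewrite in_itv /= andbT => /ltW x0.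
  by have dx := F' x x0; rewrite derive1E derive_val dF0.
- apply: continuous_in_subspaceT => x; rewrite inE /= in_itv /= andbT => /F' dx.
  by apply/differentiable_continuous/derivable1_diffP; exact: ex_derive.
Qed.

Lemma is_derive_ln1D x : 0 <= x -> is_derive x 1 (fun t : R => ln (1 + t)) (1 + x)^-1.
Proof.
move=> x0; have x1 : 0 < 1 + x by rewrite ltr_pwDl.
have := @is_derive1_comp R (@ln R) (cst 1 + id) x (1 + x)^-1 1 (is_derive1_ln x1).
rewrite mulr1; apply; apply: is_derive_eq; exact: add0r.
Qed.

(** Exact enough, as is [ln1D_upper], for the differences of [stirling_log]: the
    expansions agree up to the order [t^2]. *)
Lemma ln1D_lower t : 0 <= t -> 2 * t / (2 + t) <= ln (1 + t).
Proof.
move=> t0; pose F u : R := ln (1 + u) + (4 * (2 + u)^-1 - 2).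
have F' x : 0 <= x -> is_derive x 1 F (x ^+ 2 / ((1 + x) * (2 + x) ^+ 2)).
  move=> x0; have x2 : 2 + x != 0 by rewrite gt_eqF // ltr_pwDl.
  have x1 : 1 + x != 0 by rewrite gt_eqF // ltr_pwDl.
  have d1 : is_derive x 1 (fun u : R => 2 + u) 1.
    have : is_derive x 1 (cst (2 : R) + id) (0 + 1) by apply: is_deriveD.
    by rewrite add0r.
  have d2 := @is_deriveV _ _ x 1 1 x2 d1.
  have d3 := is_deriveZ 4 d2.
  have d4 := is_deriveD (is_derive_ln1D x0) (is_deriveB d3 (is_derive_cst (2 : R) x 1)).
  apply: (is_derive_conv _ _ d4) => //.
  by rewrite /GRing.scale /=; field; rewrite x1 x2.
have F0 : F 0 = 0 by rewrite /F !addr0 ln1; field.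
have := ge0_of_derive F' _ F0 t0; rewrite /F.
have t2 : 2 + t != 0 by rewrite gt_eqF // ltr_pwDl.
have -> : 2 * t / (2 + t) = 2 - 4 * (2 + t)^-1 by field.
move=> H; have {}H : 0 <= ln (1 + t) + (4 * (2 + t)^-1 - 2).
  apply: H => x x0; rewrite divr_ge0 ?sqr_ge0 // mulr_ge0 ?sqr_ge0 //.
  by rewrite addr_ge0.
by move: (ln _) H => l; lra.
Qed.

Lemma ln1D_upper t : 0 <= t -> ln (1 + t) <= t - t ^+ 2 / 2 + t ^+ 3 / 3.
Proof.
move=> t0; pose P u : R := u - 2^-1 * u ^+ 2 + 3^-1 * u ^+ 3.
pose F u : R := P u - ln (1 + u).
have P' x : is_derive x 1 P (1 - x + x ^+ 2).
  have h1 : is_derive x 1 (fun u : R => u) 1 by exact: is_derive_id.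
  have h2 : is_derive x 1 (id ^+ 2 : R -> R) (2 * x).
    by apply: is_derive_eq; rewrite /GRing.scale /= expr1 mulr1.
  have h3 : is_derive x 1 (id ^+ 3 : R -> R) (3 * x ^+ 2).
    by apply: is_derive_eq; rewrite /GRing.scale /= mulr1.
  have h4 := is_deriveD (is_deriveB h1 (is_deriveZ 2^-1 h2)) (is_deriveZ 3^-1 h3).
  apply: (is_derive_conv _ _ h4) => [u|]; last by rewrite /GRing.scale /=; field.
  by rewrite !fctE.
have F' x : 0 <= x -> is_derive x 1 F (x ^+ 3 / (1 + x)).
  move=> x0; have x1 : 1 + x != 0 by rewrite gt_eqF // ltr_pwDl.
  by apply: (is_derive_conv _ _ (is_deriveB (P' x) (is_derive_ln1D x0))) => //; field.
have F0 : F 0 = 0 by rewrite /F /P addr0 ln1; ring.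
have H : 0 <= F t.
  apply: (ge0_of_derive F') => // x x0.
  by rewrite divr_ge0 ?exprn_ge0 // addr_ge0.
by move: H; rewrite /F /P subr_ge0 => /le_trans; apply; lra.
Qed.

(** The logarithm of [n! / ((n / e)^n sqrt n)] at [n = k + 1]. *)
Definition stirling_log k : R :=
  ln k.+1`!%:R + k.+1%:R - k.+1%:R * ln k.+1%:R - ln k.+1%:R / 2.

Lemma stirling_log_step k : let t : R := k.+1%:R^-1 in
  stirling_log k - stirling_log k.+1 = (t^-1 + 1 / 2) * ln (1 + t) - 1.
Proof.
move=> t; have n0 : 0 < k.+1%:R :> R by rewrite ltr0n.
have m0 : 0 < k.+2%:R :> R by rewrite ltr0n.
have -> : 1 + t = k.+2%:R / k.+1%:R.
  by rewrite /t -[k.+2%:R]natr1; field; rewrite gt_eqF.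
rewrite ln_div ?posrE // /t invrK /stirling_log [k.+2`!]factS natrM.
rewrite lnM ?posrE ?ltr0n ?fact_gt0 //.
move: (ln k.+2%:R) (ln k.+1%:R) (ln (k.+1)`!%:R) => a b c.
by rewrite -[k.+2%:R]natr1; field.
Qed.

Lemma stirling_log_decr k : stirling_log k.+1 <= stirling_log k.
Proof.
rewrite -subr_ge0 stirling_log_step; set t : R := k.+1%:R^-1.
have t0 : 0 < t by rewrite invr_gt0 ltr0n.
have H := ln1D_lower (ltW t0).
have : (t^-1 + 1 / 2) * (2 * t / (2 + t)) <= (t^-1 + 1 / 2) * ln (1 + t).
  by rewrite ler_wpM2l // addr_ge0 ?invr_ge0 ?divr_ge0 // ltW.
have -> : (t^-1 + 1 / 2) * (2 * t / (2 + t)) = 1.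
  by field; rewrite (gt_eqF t0) gt_eqF // ltr_pwDl // ltW.
by rewrite subr_ge0.
Qed.

(** The sequence [stirling_log k - 1 / (2 (k + 1))] starts at [1 / 2] and is
    nondecreasing. *)
Lemma stirling_log_lower k : 1 / 2 <= stirling_log k.
Proof.
suff : 1 / 2 <= stirling_log k - k.+1%:R^-1 / 2.
  have : 0 <= k.+1%:R^-1 :> R by rewrite invr_ge0.
  by move: (stirling_log k) (k.+1%:R^-1) => a b; lra.
elim: k => [|k IH].
  rewrite /stirling_log (_ : 1`! = 1%N) // ln1 invr1.
  lra.
apply: (le_trans IH); rewrite -subr_ge0.
have := stirling_log_step k; set t : R := k.+1%:R^-1 => /= E.
have t0 : 0 < t by rewrite invr_gt0 ltr0n.
have t1 : t <= 1 by rewrite invf_le1 ?ltr0n // ler1n.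
have -> : k.+2%:R^-1 = t / (1 + t) :> R.
  have n0 : k.+1%:R != 0 :> R by rewrite pnatr_eq0.
  have m0 : k.+1%:R + 1 != 0 :> R by rewrite natr1 pnatr_eq0.
  rewrite /t -[k.+2%:R]natr1; move: (k.+1%:R : R) n0 m0 => u n0 m0.
  by field; rewrite ?n0 ?m0.
have H : (t^-1 + 1 / 2) * ln (1 + t) <= 1 + t ^+ 2 / 12 + t ^+ 3 / 6.
  apply: le_trans (_ : (t^-1 + 1 / 2) * (t - t ^+ 2 / 2 + t ^+ 3 / 3) <= _).
    rewrite ler_wpM2l ?ln1D_upper // ?addr_ge0 ?invr_ge0 ?divr_ge0 // ltW //.
  by rewrite le_eqVlt; apply/orP; left; apply/eqP; field; rewrite gt_eqF.
have H2 : t ^+ 2 / 12 + t ^+ 3 / 6 <= (t - t / (1 + t)) / 2.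
  have -> : t - t / (1 + t) = t ^+ 2 / (1 + t).
    by field; rewrite gt_eqF // ltr_pwDl // ltW.
  have t3 : t ^+ 3 <= t ^+ 2.
    by rewrite exprS ler_piMl // ?exprn_ge0 // ltW.
  apply: le_trans (_ : t ^+ 2 / 4 <= _); first by lra.
  rewrite -mulrA ler_wpM2l ?sqr_ge0 // -invfM lef_pV2 ?posrE //; last first.
    by rewrite mulr_gt0 // ltr_pwDl // ltW.
  lra.
move: E H H2; move: (stirling_log _) (stirling_log _) (ln _) (t / (1 + t)).
by move=> a b c d; lra.
Qed.

Lemma stirling_log_cvg : cvgn stirling_log.
Proof.
apply: nonincreasing_is_cvgn; first exact/nonincreasing_seqP/stirling_log_decr.
by exists (1 / 2) => _ [k _ <-]; exact: stirling_log_lower.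
Qed.

(** The reciprocal [(n / e)^n sqrt n / n!] of the ratio in Stirling's formula,
    which is the form that occurs in the weight of the trees. *)
Definition stirling n : R := n%:R ^+ n * expR (- n%:R) * Num.sqrt n%:R / n`!%:R.

Lemma stirlingE k : stirling k.+1 = expR (- stirling_log k).
Proof.
have n0 : 0 < k.+1%:R :> R by rewrite ltr0n.
have f0 : 0 < k.+1`!%:R :> R by rewrite ltr0n fact_gt0.
rewrite /stirling_log !opprD !opprK !expRD expRN lnK ?posrE //.
have -> : expR (k.+1%:R * ln k.+1%:R) = k.+1%:R ^+ k.+1 :> R.
  by rewrite expRM_natl lnK ?posrE.
have -> : expR (ln k.+1%:R / 2) = Num.sqrt k.+1%:R :> R.
  rewrite -[k.+1%:R in RHS]lnK ?posrE // {2}[ln _]splitr expRD.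
  by rewrite -expr2 sqrtr_sqr ger0_norm ?expR_ge0.
rewrite /stirling; ring.
Qed.

Lemma stirling_cvg_pos : exists2 l : R, 0 < l & stirling @ \oo --> l.
Proof.
exists (expR (- limn stirling_log)); first exact: expR_gt0.
rewrite -(cvg_shiftS stirling).
under eq_fun do rewrite stirlingE.
apply: continuous_cvg; first exact: continuous_expR.
by apply: cvgN; exact: stirling_log_cvg.
Qed.

Lemma stirling_double n :
  stirling n.*2 ^+ 2 * (n.*2%:R * central_ratio R n ^+ 2) = 4 * stirling n ^+ 4.
Proof.
have [->|n_gt0] := posnP n.
  by rewrite /stirling sqrtr0 !(mulr0, mul0r) !expr0n !(mulr0, mul0r).
have u0 : n%:R != 0 :> R by rewrite pnatr_eq0 -lt0n.
have f0 : n`!%:R != 0 :> R by rewrite pnatr_eq0 -lt0n fact_gt0.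
have g0 : n.*2`!%:R != 0 :> R by rewrite pnatr_eq0 -lt0n fact_gt0.
have d0 : 2 ^+ n != 0 :> R by rewrite expf_neq0 // pnatr_eq0.
have u2 : n.*2%:R = 2 * n%:R :> R by rewrite -natrM mul2n.
have e2 : expR (- n.*2%:R) = expR (- n%:R) ^+ 2 :> R.
  by rewrite -expRM_natl u2; congr expR; ring.
have a2 : n.*2%:R ^+ n.*2 = (2 ^+ n * n%:R ^+ n) ^+ 2 :> R.
  by rewrite u2 -exprMn -exprM muln2.
have f4 : 4 ^+ n = (2 ^+ n) ^+ 2 :> R.
  by rewrite -!exprM mulnC exprM expr2 -natrM.
have r2 : Num.sqrt n.*2%:R ^+ 2 = 2 * n%:R :> R by rewrite sqr_sqrtr ?ler0n.
have q2 : Num.sqrt n%:R ^+ 2 = n%:R :> R by rewrite sqr_sqrtr ?ler0n.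
rewrite /stirling /central_ratio a2 e2 f4 u2 in r2 *.
move: (n`!%:R) (n.*2`!%:R) (expR _) (2 ^+ n) (n%:R ^+ n) f0 g0 d0 r2 q2 => f g e d a.
move: (Num.sqrt (2 * n%:R)) (Num.sqrt n%:R) => r q f0 g0 d0 r2 q2.
transitivity (a ^+ 4 * e ^+ 4 * (r ^+ 2) * (2 * n%:R) / f ^+ 4).
  by field; rewrite f0 g0 d0.
rewrite r2; transitivity (4 * (a ^+ 4 * e ^+ 4 * (q ^+ 2) ^+ 2 / f ^+ 4)).
  by rewrite q2; field.
by field.
Qed.

Lemma cvgn_double : n.*2 @[n --> \oo] --> \oo.
Proof.
apply: cvg_trans (_ : n.*2 @[n --> \oo] `=>` \oo) => // A [N _ AN].
by exists N => // n /= Nn; apply: AN; rewrite /= (leq_trans Nn) // -addnn leq_addr.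
Qed.

Lemma central_ratio_cvg : n.*2%:R * central_ratio R n ^+ 2 @[n --> \oo] --> 2 / pi.
Proof.
have p0 : 0 < 2 / pi :> R by rewrite divr_gt0 ?pi_gt0.
have lo : 2 / pi * (1 - n.+1%:R^-1) @[n --> \oo] --> (2 / pi : R).
  have h1 : 1 - n.+1%:R^-1 @[n --> \oo] --> (1 - 0 : R).
    by apply: cvgB; [exact: cvg_cst|exact: cvg_harmonic].
  have : 2 / pi * (1 - n.+1%:R^-1) @[n --> \oo] --> 2 / pi * (1 - 0 : R).
    by apply: cvgM h1; exact: cvg_cst.
  by rewrite subr0 mulr1.
apply: (squeeze_cvgr _ lo (cvg_cst (2 / pi))); near=> n.
have /andP[h1 h2] := central_ratio_bounds R n; rewrite h1 andbT.
have n0 : 0 < n.+1%:R :> R by rewrite ltr0n.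
have m0 : 0 < n.*2.+1%:R :> R by rewrite ltr0n.
have {}h2 : 2 / pi / n.*2.+1%:R <= central_ratio R n ^+ 2.
  by rewrite ler_pdivrMr // (mulrC (_ ^+ 2)).
apply: le_trans (_ : n.*2%:R * (2 / pi / n.*2.+1%:R) <= _); last first.
  by rewrite ler_wpM2l.
move: (2 / pi : R) p0 => k k0; rewrite [leRHS]mulrCA ler_wpM2l ?(ltW k0) //.
rewrite ler_pdivlMr // mulrC.
apply: le_trans (_ : n.*2.+1%:R - n.*2.+1%:R / n.+1%:R <= _).
  by rewrite mulrBr mulr1.
rewrite lerBlDr -lerBlDl -natrB // subSnn ler_pdivlMr // mul1r ler_nat.
by rewrite ltnS -addnn leq_addr.
Unshelve. all: by end_near. Qed.

(** The limit [l > 0] exists by monotonicity, and the Wallis integrals force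
    [4 l^4 = l^2 * (2 / pi)]. *)
Lemma stirling_cvg : stirling @ \oo --> (Num.sqrt (2 * pi))^-1.
Proof.
have [l l0 cl] := stirling_cvg_pos.
have cl2 : stirling n.*2 @[n --> \oo] --> l by apply: cvg_comp cl; apply: cvgn_double.
have c1 : stirling n.*2 ^+ 2 * (n.*2%:R * central_ratio R n ^+ 2) @[n --> \oo] -->
    l ^+ 2 * (2 / pi).
  by apply: cvgM central_ratio_cvg; rewrite !expr2; apply: cvgM.
have c2 : 4 * stirling n ^+ 4 @[n --> \oo] --> 4 * l ^+ 4.
  apply: cvgM; first exact: cvg_cst.
  apply: (@continuous_cvg _ _ _ _ _ _ (fun y : R => y ^+ 4)) => //.
  exact: exprn_continuous.
have E : l ^+ 2 * (2 / pi) = 4 * l ^+ 4.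
  have c1' : 4 * stirling n ^+ 4 @[n --> \oo] --> l ^+ 2 * (2 / pi).
    by under eq_cvg do rewrite -stirling_double.
  exact: (cvg_unique (@norm_hausdorff _ _) c1' c2).
suff -> : (Num.sqrt (2 * pi))^-1 = l by [].
have p0 := pi_gt0 R.
have l2 : l ^+ 2 = (2 * pi)^-1.
  apply: (@mulfI _ (4 * l ^+ 2)); first by rewrite mulf_neq0 ?expf_neq0 ?gt_eqF.
  rewrite -mulrA -exprD -E; move: (pi : R) p0 => P P0.
  by field; rewrite gt_eqF.
by rewrite -sqrtrV ?mulr_ge0 ?ltW // -l2 sqrtr_sqr ger0_norm // ltW.
Qed.

Lemma stirling_bounded : exists2 K : R, 0 < K & forall n, `|stirling n| <= K.
Proof.
have /cvg_seq_bounded[M [_ HM]] : cvgn stirling.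
  by apply/cvg_ex; eexists; exact: stirling_cvg.
exists (`|M| + 1); first by rewrite ltr_wpDl.
move=> n; apply: HM => //; rewrite (le_lt_trans (ler_norm M)) //.
by rewrite ltrDl.
Qed.

End Stirling.

(** * Asymptotics of one term *)

Section TermAsymptotics.
Local Open Scope classical_set_scope.
Variable R : realType.
Implicit Types (s x u : R) (N m : nat).

(** Counterpart of [expR_ge1Dx], obtained from
    [1 / (1 + u) = 1 - u / (1 + u) <= exp (- u / (1 + u))]. *)
Lemma expR_le1Dx u : `|u| <= 1 / 2 -> expR (u - 2 * u ^+ 2) <= 1 + u.
Proof.
rewrite ler_norml => /andP[u1 u2].
have v0 : 0 < 1 + u by lra.
apply: le_trans (_ : expR (u / (1 + u)) <= _).
  rewrite ler_expR ler_pdivlMr //.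
  have -> : (u - 2 * u ^+ 2) * (1 + u) = u - u ^+ 2 * (1 + 2 * u) by ring.
  have : 0 <= u ^+ 2 * (1 + 2 * u) by rewrite mulr_ge0 ?sqr_ge0 //; lra.
  by move: (_ * _) => a; lra.
have h := expR_ge1Dx (- (u / (1 + u))).
rewrite -[leLHS]invrK -[leRHS]invrK lef_pV2 ?posrE ?invr_gt0 ?expR_gt0 //.
rewrite -expRN; apply: le_trans h.
by rewrite le_eqVlt; apply/orP; left; apply/eqP; field; rewrite gt_eqF.
Qed.

(** The probability that [m] draws with replacement among [N + 2] labels are
    distinct and avoid two given labels. *)
Definition falling_ratio N m : R := (N ^_ m)%:R / N.+2%:R ^+ m.

Lemma falling_ratioS N m :
  falling_ratio N m.+1 = falling_ratio N m * ((N - m)%:R / N.+2%:R).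
Proof.
by rewrite /falling_ratio ffactnSr natrM exprSr invfM; ring.
Qed.

Lemma falling_ratio_ge0 N m : 0 <= falling_ratio N m.
Proof. by rewrite divr_ge0 ?exprn_ge0 ?ler0n. Qed.

(** Each factor [1 - (j + 2) / V] is at most [exp (- (j + 2) / V)]. *)
Lemma falling_ratio_le N m :
  falling_ratio N m <= expR (- (m%:R * (m%:R + 3) / 2 / N.+2%:R)).
Proof.
have V0 : 0 < N.+2%:R :> R by rewrite ltr0n.
elim: m => [|m IH].
  by rewrite /falling_ratio ffactn0 divr1 !mul0r oppr0 expR0.
rewrite falling_ratioS.
have -> : - (m.+1%:R * (m.+1%:R + 3) / 2 / N.+2%:R) =
    - (m%:R * (m%:R + 3) / 2 / N.+2%:R) + - (m.+2%:R / N.+2%:R) :> R.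
  by rewrite -[m.+2%:R]natr1 -!natr1; move: (m%:R) => k; field; rewrite natr1 gt_eqF.
rewrite expRD ler_pM ?falling_ratio_ge0 ?divr_ge0 ?ler0n //.
have [mN|Nm] := leqP m N; last first.
  by rewrite (eqP (ltnW Nm)) mul0r expR_ge0.
apply: le_trans (expR_ge1Dx _).
rewrite natrB // -[N.+2%:R]natr1 -[N.+1%:R]natr1 -[m.+2%:R]natr1 -[m.+1%:R]natr1.
rewrite le_eqVlt; apply/orP; left; apply/eqP; field.
by rewrite !natr1 gt_eqF.
Qed.

(** The factors are bounded below by [expR_le1Dx], and the error terms
    [2 (j + 2)^2 / V^2] are summed crudely. *)
Lemma falling_ratio_ge N m : (m.+1.*2 <= N.+2)%N ->
  expR (- (m%:R * (m%:R + 3) / 2 / N.+2%:R)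
        - 2 * m%:R * (m%:R + 1) ^+ 2 / N.+2%:R ^+ 2) <= falling_ratio N m.
Proof.
have V0 : 0 < N.+2%:R :> R by rewrite ltr0n.
elim: m => [|m IH] mN.
  by rewrite /falling_ratio ffactn0 divr1 !(mul0r, mulr0) oppr0 addr0 expR0.
rewrite falling_ratioS; set w : R := m.+2%:R / N.+2%:R.
have wE : w = m%:R / N.+2%:R + 2 / N.+2%:R.
  by rewrite /w -[m.+2%:R]natr1 -[m.+1%:R]natr1; ring.
have w0 : 0 <= w by rewrite divr_ge0 ?ler0n.
have w1 : `|- w| <= 1 / 2.
  rewrite normrN ger0_norm // ler_pdivrMr // mulrC mulrA mulr1.
  by rewrite ler_pdivlMr // -natrM ler_nat muln2.
have -> : (N - m)%:R / N.+2%:R = 1 + - w.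
  have mN' : (m <= N)%N by move: mN; rewrite -addnn; lia.
  rewrite natrB // /w -[N.+2%:R]natr1 -[N.+1%:R]natr1 -[m.+2%:R]natr1 -[m.+1%:R]natr1.
  by field; rewrite !natr1 gt_eqF.
apply: le_trans (_ : falling_ratio N m * expR (- w - 2 * (- w) ^+ 2) <= _); last first.
  by rewrite ler_wpM2l ?falling_ratio_ge0 // expR_le1Dx.
have mN2 : (m.+1.*2 <= N.+2)%N by apply: leq_trans mN; rewrite leq_double.
apply: le_trans (ler_wpM2r (expR_ge0 _) (IH mN2)).
rewrite -expRD ler_expR wE -[m.+1%:R]natr1.
have k0 : 0 <= m%:R :> R by rewrite ler0n.
have V1 : 0 <= N.+2%:R^-1 :> R by rewrite invr_ge0 ltW.
move: (m%:R : R) k0 => k k0; rewrite -exprVn; move: (N.+2%:R^-1 : R) V1 => v v0.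
rewrite -subr_ge0.
set d := (X in 0 <= X); have -> : d = 2 * v ^+ 2 * k * (2 * k + 3) by rewrite /d; field.
by rewrite !mulr_ge0 ?sqr_ge0 // addr_ge0 // mulr_ge0.
Qed.

Definition sqrtV N : R := Num.sqrt N.+2%:R.

(** The weight [p / (e V)] of an edge at [p = 1 + s V^(-1/2)]. *)
Definition window_fugacity s N : R := (1 + s / sqrtV N) / (expR 1 * N.+2%:R).

Lemma sqrtV_gt0 N : 0 < sqrtV N.
Proof. by rewrite sqrtr_gt0 ltr0n. Qed.

Lemma sqrtV_sqr N : sqrtV N ^+ 2 = N.+2%:R.
Proof. by rewrite sqr_sqrtr ?ler0n. Qed.

Lemma sqrtV_ge1 N : 1 <= sqrtV N.
Proof. by rewrite -[1]sqrtr1 ler_wsqrtr // ler1n. Qed.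

(** [V^(5/4)] times a term of the sum over trees, written as a product of factors
    that converge separately when [m] is close to [x V^(1/2)]. *)
Definition scaled_term s N m : R :=
  expR 1 * falling_ratio N m * (1 + s / sqrtV N) ^+ m.+1 * stirling R m.+2 *
  (m.+1%:R / m.+2%:R) * Num.sqrt (sqrtV N / m.+2%:R).

Lemma scaled_termE s N m :
  'C(N, m)%:R * tree_weight m.+2 (window_fugacity s N) *
  (Num.sqrt (sqrtV N) * N.+2%:R) = scaled_term s N m.
Proof.
have V0 : N.+2%:R != 0 :> R by rewrite pnatr_eq0.
have n0 : m.+2%:R != 0 :> R by rewrite pnatr_eq0.
have n1 : m.+1%:R != 0 :> R by rewrite pnatr_eq0.
have f0 : m`!%:R != 0 :> R by rewrite pnatr_eq0 -lt0n fact_gt0.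
rewrite /scaled_term /falling_ratio /stirling /tree_weight /window_fugacity.
rewrite sqrtrM ?sqrtr_ge0 // sqrtrV ?ler0n // -bin_ffact natrM.
have -> : m.+2`!%:R = m.+2%:R * (m.+1%:R * m`!%:R) :> R by rewrite !factS !natrM.
have eE : expR m.+2%:R = expR 1 ^+ m.+2 :> R by rewrite -expRM_natl mulr1.
rewrite expRN eE [m.+2.-1]/= exprMn exprVn exprMn [expR 1 ^+ m.+2]exprS.
rewrite [N.+2%:R ^+ m.+1]exprS.
have e0 : expR 1 != 0 :> R by rewrite gt_eqF ?expR_gt0.
have em : expR 1 ^+ m.+1 != 0 :> R by rewrite expf_neq0.
have Vm : N.+2%:R ^+ m != 0 :> R by rewrite expf_neq0.
have s0 : Num.sqrt m.+2%:R != 0 :> R by rewrite gt_eqF // sqrtr_gt0 ltr0n.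
move: (expR 1 ^+ m.+1) em => em em0.
move: (N.+2%:R ^+ m) Vm => Vm Vm0.
move: (m.+2%:R ^+ m.+2) => nn; move: ((1 + s / sqrtV N) ^+ m.+1) => pm.
move: (Num.sqrt (sqrtV N)) (Num.sqrt m.+2%:R) s0 => sr sn sn0.
move: (m.+2%:R) n0 (m.+1%:R) n1 => n n0 n1 n10.
move: (m`!%:R) f0 (N.+2%:R) V0 (expR 1) e0 => f f0 V V0 e e0.
by field; rewrite ?n0 ?n10 ?f0 ?V0 ?e0 ?em0 ?Vm0 ?sn0.
Qed.

Lemma scaled_term_gtN s N m : (N < m)%N -> scaled_term s N m = 0.
Proof. by move=> Nm; rewrite -scaled_termE bin_small // !mul0r. Qed.

End TermAsymptotics.

Section PointwiseLimit.
Local Open Scope classical_set_scope.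
Variable R : realType.
Implicit Types (s x : R) (N m : nat).

Lemma inv_sqrtV_cvg0 : (sqrtV R N)^-1 @[N --> \oo] --> (0 : R).
Proof.
have h : N.+2%:R^-1 @[N --> \oo] --> (0 : R).
  by have := @cvg_harmonic R; rewrite -(cvg_shiftS (@harmonic R)).
have K : Num.sqrt N.+2%:R^-1 @[N --> \oo] --> Num.sqrt (0 : R).
  by apply: continuous_cvg h; exact: sqrt_continuous.
rewrite sqrtr0 in K.
apply: (cvg_trans _ K); apply: near_eq_cvg; near=> N.
by rewrite /sqrtV sqrtrV ?ler0n.
Unshelve. all: by end_near. Qed.

Variables (m_ : nat -> nat) (x : R).
Hypothesis x_gt0 : 0 < x.
Hypothesis m_cvg : (m_ N)%:R / sqrtV R N @[N --> \oo] --> x.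

Let sqrtV_neq0 N : sqrtV R N != 0.
Proof. by rewrite gt_eqF ?sqrtV_gt0. Qed.

Lemma shifted_cvg k : (m_ N + k)%:R / sqrtV R N @[N --> \oo] --> x.
Proof.
have h : (m_ N)%:R / sqrtV R N + k%:R * (sqrtV R N)^-1 @[N --> \oo] --> x + k%:R * 0.
  by apply: cvgD m_cvg _; apply: cvgM; [exact: cvg_cst|exact: inv_sqrtV_cvg0].
rewrite mulr0 addr0 in h.
by under eq_cvg do rewrite natrD mulrDl.
Qed.

Lemma index_cvgy : m_ @ \oo --> \oo.
Proof.
apply/cvgnyPge => A.
have hx : \forall N \near \oo, x / 2 < (m_ N)%:R / sqrtV R N.
  by apply: (cvgr_gt x) => //; rewrite ltr_pdivrMr // ltr_pMr // ltr1n.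
have hr : \forall N \near \oo, (sqrtV R N)^-1 < x / 2 / A.+1%:R.
  by apply: (cvgr_lt 0 inv_sqrtV_cvg0); rewrite !divr_gt0.
near=> N.
have h1 : x / 2 < (m_ N)%:R / sqrtV R N by near: N.
have h2 : (sqrtV R N)^-1 < x / 2 / A.+1%:R by near: N.
have r0 := sqrtV_gt0 R N; have A0 : 0 < A.+1%:R :> R by rewrite ltr0n.
rewrite -(ler_nat R); apply: le_trans (_ : A.+1%:R <= _); first by rewrite ler_nat.
rewrite -(ler_pM2r (x := (sqrtV R N)^-1)) ?invr_gt0 //; apply: ltW.
by apply: lt_trans h1; move: h2; rewrite ltr_pdivlMr // mulrC.
Unshelve. all: by end_near. Qed.

Lemma falling_ratio_cvg :
  falling_ratio R N (m_ N) @[N --> \oo] --> expR (- (x ^+ 2 / 2)).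
Proof.
pose a N : R := (m_ N)%:R / sqrtV R N; pose e N : R := (sqrtV R N)^-1.
have ca : a @ \oo --> x by [].
have ce : e @ \oo --> (0 : R) by exact: inv_sqrtV_cvg0.
pose up N : R := expR (- (a N * (a N + 3 * e N) / 2)).
pose lo N : R := expR (- (a N * (a N + 3 * e N) / 2)
   - 2 * a N * (a N + e N) ^+ 2 * e N).
have c3 : a N * (a N + 3 * e N) / 2 @[N --> \oo] --> x * (x + 3 * 0) / 2.
  apply: cvgM; last exact: cvg_cst.
  apply: cvgM => //; apply: cvgD => //.
  by apply: cvgM => //; exact: cvg_cst.
rewrite mulr0 addr0 -expr2 in c3.
have c4 : 2 * a N * (a N + e N) ^+ 2 * e N @[N --> \oo] -->
    2 * x * ((x + 0) * (x + 0)) * 0.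
  apply: cvgM => //; apply: cvgM; first by apply: cvgM => //; exact: cvg_cst.
  by under eq_cvg do rewrite expr2; apply: cvgM; apply: cvgD.
rewrite mulr0 in c4.
have cup : up @ \oo --> expR (- (x ^+ 2 / 2)).
  by apply: continuous_cvg; [exact: continuous_expR | exact: cvgN].
have clo : lo @ \oo --> expR (- (x ^+ 2 / 2)).
  rewrite -[- (x ^+ 2 / 2)]subr0.
  apply: continuous_cvg; first exact: continuous_expR.
  by apply: cvgB => //; exact: cvgN.
have small : \forall N \near \oo, a N * e N + e N ^+ 2 < 1 / 2.
  apply: (cvgr_lt (x * 0 + 0 * 0)); last by rewrite !mulr0 addr0.
  by apply: cvgD; [exact: cvgM | under eq_cvg do rewrite expr2; exact: cvgM].
apply: (squeeze_cvgr _ clo cup); near=> N.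
have r2 : N.+2%:R = sqrtV R N ^+ 2 by rewrite sqrtV_sqr.
have r0 := sqrtV_neq0 N.
have upE : up N = expR (- ((m_ N)%:R * ((m_ N)%:R + 3) / 2 / N.+2%:R)).
  rewrite /up /a /e r2; congr (expR (- _)).
  by move: (sqrtV R N) r0 => r r0; field.
apply/andP; split; last by rewrite upE; exact: falling_ratio_le.
have loE : lo N = expR (- ((m_ N)%:R * ((m_ N)%:R + 3) / 2 / N.+2%:R)
    - 2 * (m_ N)%:R * ((m_ N)%:R + 1) ^+ 2 / N.+2%:R ^+ 2).
  have -> : (m_ N)%:R * ((m_ N)%:R + 3) / 2 / N.+2%:R =
      a N * (a N + 3 * e N) / 2.
    by rewrite /a /e r2; move: (sqrtV R N) r0 => r r0; field.
  have -> // : 2 * (m_ N)%:R * ((m_ N)%:R + 1) ^+ 2 / N.+2%:R ^+ 2 =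
      2 * a N * (a N + e N) ^+ 2 * e N.
  by rewrite /a /e r2; move: (sqrtV R N) r0 => r r0; field.
rewrite loE; apply: falling_ratio_ge.
have h : a N * e N + e N ^+ 2 < 1 / 2 by near: N.
rewrite -(ler_nat R) r2; apply: ltW; move: h; rewrite /a /e.
rewrite -muln2 natrM -[(m_ N).+1%:R]natr1.
have r1 := sqrtV_gt0 R N.
move: (sqrtV R N) r1 => r r1.
have -> : (m_ N)%:R / r / r + r^-1 ^+ 2 = ((m_ N)%:R + 1) / r ^+ 2.
  by field; rewrite gt_eqF.
rewrite ltr_pdivrMr ?exprn_gt0 //.
move: (r ^+ 2) (m_ N)%:R => w k; lra.
Unshelve. all: by end_near. Qed.

Lemma power_cvg s :
  (1 + s / sqrtV R N) ^+ (m_ N).+1 @[N --> \oo] --> expR (s * x).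
Proof.
pose a N : R := (m_ N + 1)%:R / sqrtV R N; pose e N : R := (sqrtV R N)^-1.
have ca : a @ \oo --> x by exact: shifted_cvg.
have ce : e @ \oo --> (0 : R) by exact: inv_sqrtV_cvg0.
have cup : expR (s * a N) @[N --> \oo] --> expR (s * x).
  apply: continuous_cvg; first exact: continuous_expR.
  by apply: cvgM => //; exact: cvg_cst.
have clo : expR (s * a N - 2 * s ^+ 2 * (a N * e N)) @[N --> \oo] --> expR (s * x).
  rewrite -[s * x]subr0 -[X in _ - X](mulr0 (2 * s ^+ 2)) -[X in _ - _ * X](mulr0 x).
  apply: continuous_cvg; first exact: continuous_expR.
  apply: cvgB; first by apply: cvgM => //; exact: cvg_cst.
  by apply: cvgM; [exact: cvg_cst | exact: cvgM].
have small : \forall N \near \oo, `|s * e N| < 1 / 2.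
  apply: (cvgr_norm_lt (s * 0)); last by rewrite mulr0 normr0.
  by apply: cvgM => //; exact: cvg_cst.
apply: (squeeze_cvgr _ clo cup); near=> N.
have h : `|s * e N| <= 1 / 2 by apply: ltW; near: N.
have h1 : 0 <= 1 + s * e N.
  by move: h; rewrite ler_norml => /andP[? _]; lra.
have r0 := sqrtV_neq0 N.
rewrite -/(e N); apply/andP; split; last first.
  have -> : s * a N = (m_ N).+1%:R * (s * e N) by rewrite /a /e addn1; ring.
  by rewrite expRM_natl lerXn2r ?nnegrE ?expR_ge0 // expR_ge1Dx.
have -> : s * a N - 2 * s ^+ 2 * (a N * e N) =
    (m_ N).+1%:R * (s * e N - 2 * (s * e N) ^+ 2) by rewrite /a /e addn1; ring.
by rewrite expRM_natl lerXn2r ?nnegrE ?expR_ge0 // expR_le1Dx.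
Unshelve. all: by end_near. Qed.

Definition profile_density s x : R :=
  expR (- (1 / 2) * x ^+ 2 + s * x) * (1 / Num.sqrt x).

Lemma scaled_term_cvg s : scaled_term s N (m_ N) @[N --> \oo] -->
  expR 1 / Num.sqrt (2 * pi) * profile_density s x.
Proof.
have c1 := shifted_cvg 1; have c2 := shifted_cvg 2.
have xN0 : x != 0 by rewrite gt_eqF.
have cst : stirling R (m_ N).+2 @[N --> \oo] --> (Num.sqrt (2 * pi))^-1.
  apply: (cvg_comp (fun N => (m_ N).+2) (stirling R)); last exact: stirling_cvg.
  apply/cvgnyPge => A; have /cvgnyPge/(_ A) := index_cvgy; apply: filterS => N.
  by move=> h; rewrite (leq_trans h) // -addn2 leq_addr.
have cq : (m_ N).+1%:R / (m_ N).+2%:R @[N --> \oo] --> (1 : R).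
  have K : (m_ N + 1)%:R / sqrtV R N * ((m_ N + 2)%:R / sqrtV R N)^-1
      @[N --> \oo] --> x / x by apply: cvgM => //; exact: cvgV.
  rewrite divff // in K; apply: (cvg_trans _ K); apply: near_eq_cvg; near=> N.
  rewrite addn1 addn2.
  have n0 : (m_ N).+2%:R != 0 :> R by rewrite pnatr_eq0.
  have r0 := sqrtV_neq0 N; move: ((m_ N).+2%:R : R) n0 ((m_ N).+1%:R : R) => n n0 k.
  by move: (sqrtV R N) r0 => r r0; field; rewrite n0 r0.
have cs : Num.sqrt (sqrtV R N / (m_ N).+2%:R) @[N --> \oo] --> 1 / Num.sqrt x.
  have h : ((m_ N + 2)%:R / sqrtV R N)^-1 @[N --> \oo] --> x^-1 by exact: cvgV.
  have K : Num.sqrt ((m_ N + 2)%:R / sqrtV R N)^-1 @[N --> \oo] --> Num.sqrt x^-1.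
    by apply: continuous_cvg h; exact: sqrt_continuous.
  rewrite div1r -sqrtrV ?ltW //; apply: (cvg_trans _ K); apply: near_eq_cvg; near=> N.
  by rewrite addn2 invf_div.
have K : scaled_term s N (m_ N) @[N --> \oo] -->
    expR 1 * expR (- (x ^+ 2 / 2)) * expR (s * x) * (Num.sqrt (2 * pi))^-1 * 1 *
    (1 / Num.sqrt x).
  apply: cvgM cs; apply: cvgM cq; apply: cvgM cst.
  have cp := @power_cvg s; apply: cvgM cp.
  by apply: cvgM falling_ratio_cvg; exact: cvg_cst.
suff <- : expR 1 * expR (- (x ^+ 2 / 2)) * expR (s * x) * (Num.sqrt (2 * pi))^-1 *
    1 * (1 / Num.sqrt x) = expR 1 / Num.sqrt (2 * pi) * profile_density s x by [].
rewrite mulr1 /profile_density expRD.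
have -> : - (1 / 2) * x ^+ 2 = - (x ^+ 2 / 2) by field.
ring.
Unshelve. all: by end_near. Qed.

End PointwiseLimit.

(** * Dominated convergence for Riemann sums *)

Section ArctanDensity.
Local Open Scope classical_set_scope.
Variable R : realType.
Notation mu := (@lebesgue_measure R).

(** Comparison function for the dominated convergence; it is the derivative of
    [2 atan (sqrt x)], which stays below [pi]. *)
Definition arctan_density (x : R) : R := (Num.sqrt x * (1 + x))^-1.

Lemma arctan_density_ge0 x : 0 < x -> 0 <= arctan_density x.
Proof. by move=> x0; rewrite invr_ge0 mulr_ge0 ?sqrtr_ge0 // addr_ge0 // ltW. Qed.

Lemma arctan_density_continuous x : 0 < x -> {for x, continuous arctan_density}.
Proof.
move=> x0; apply: (@cvgV _ _ _ _ (fun x : R => Num.sqrt x * (1 + x))).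
  by rewrite mulf_neq0 ?gt_eqF ?sqrtr_gt0 // ltr_pwDl // ltW.
apply: cvgM; first exact: sqrt_continuous.
by apply: cvgD; [exact: cvg_cst|exact: cvg_id].
Qed.

Lemma measurable_itv_continuous (f : R -> R) :
  (forall x, 0 < x -> {for x, continuous f}) ->
  measurable_fun (`]0, +oo[ : set R) f.
Proof.
move=> cf; apply: open_continuous_measurable_fun; first exact: interval_open.
by move=> x; rewrite inE /= in_itv /= andbT => /cf.
Qed.

Lemma integral_arctan_density (a b : R) : 0 < a -> a < b ->
  (\int[mu]_(x in `[a, b]) (arctan_density x)%:E <= pi%:E)%E.
Proof.
move=> a0 ab; pose F (x : R) : R := 2 * atan (Num.sqrt x).
have dF (x : R) : 0 < x -> is_derive x 1 F (arctan_density x).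
  move=> x0; have s0 : 0 < Num.sqrt x by rewrite sqrtr_gt0.
  have d1 : is_derive (Num.sqrt x) 1 (@atan R) (1 + x)^-1.
    apply: DeriveDef; first exact: derivable_atan.
    by rewrite -derive1E derive1_atan sqr_sqrtr // ltW.
  have d2 := @is_derive1_comp R (@atan R) Num.sqrt x _ _ d1 (is_derive1_sqrt x0).
  have d3 := is_deriveZ 2 d2.
  apply: (is_derive_conv _ _ d3) => //.
  have x1 : 1 + x != 0 by rewrite gt_eqF // ltr_pwDl // ltW.
  rewrite /arctan_density /GRing.scale /=; move: (Num.sqrt x) s0 => r r0.
  by field; rewrite x1 gt_eqF.
have cF (x : R) : 0 < x -> {for x, continuous F}.
  move=> x0; have d := dF x x0.
  by apply/differentiable_continuous/derivable1_diffP; exact: ex_derive.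
rewrite (@continuous_FTC2 _ _ F) //.
- rewrite -EFinB lee_fin /F.
  have h1 : atan (Num.sqrt b) < pi / 2 :> R by exact: atan_ltpi2.
  have h2 : 0 <= atan (Num.sqrt a) :> R.
    by rewrite -(@atan0 R); apply: le_atan; exact: sqrtr_ge0.
  by move: (atan _) (atan _) (pi : R) h1 h2 => u v w; lra.
- apply: continuous_in_subspaceT => x; rewrite inE /= in_itv /= => /andP[ax _].
  by apply: arctan_density_continuous; exact: lt_le_trans ax.
- split.
  + move=> x; rewrite in_itv /= => /andP[ax _].
    by have d := dF x (lt_trans a0 ax); exact: ex_derive.
  + by apply: cvg_at_right_filter; exact: cF.
  + by apply: cvg_at_left_filter; apply: cF; exact: lt_trans ab.
- move=> x; rewrite in_itv /= => /andP[ax _].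
  by have d := dF x (lt_trans a0 ax); rewrite derive1E derive_val.
Qed.

Lemma arctan_density_integrable :
  mu.-integrable `]0, +oo[ (EFin \o arctan_density).
Proof.
have mf := measurable_itv_continuous arctan_density_continuous.
apply/integrableP; split; first exact/measurable_EFinP.
under eq_integral => x.
  rewrite inE /= in_itv /= andbT => x0.
  rewrite ger0_norm ?arctan_density_ge0 //; over.
(* The half-line is exhausted by compact intervals away from 0. *)
pose F (k : nat) : set R := `[k.+1%:R^-1, k.+2%:R].
have Fpos k x : F k x -> 0 < x.
  by rewrite /F /= in_itv /= => /andP[+ _]; apply: lt_le_trans; rewrite invr_gt0.
have FU : \bigcup_k F k = `]0, +oo[.
  apply/seteqP; split=> [x [k _ /Fpos x0]|x].
    by rewrite /= in_itv /= x0.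
  rewrite /= in_itv /= andbT => x0.
  have x1 : 0 < x^-1 by rewrite invr_gt0.
  pose k := (Num.truncn x + Num.truncn x^-1)%N.
  exists k => //; rewrite /F /= in_itv /=; apply/andP; split.
    rewrite -[leRHS]invrK lef_pV2 ?posrE //.
    have /andP[_ h] := truncn_itv (ltW x1); apply: ltW; apply: lt_le_trans h _.
    by rewrite ler_nat ltnS leq_addl.
  have /andP[_ h] := truncn_itv (ltW x0); apply: ltW; apply: lt_le_trans h _.
  by rewrite ler_nat ltnS (leq_trans (leq_addr _ _) (leqnSn _)).
rewrite -FU.
have FS k : F k `<=` `]0, +oo[ by move=> x /Fpos x0; rewrite /= in_itv /= x0.
have cvgF : (\int[mu]_(x in F k) (arctan_density x)%:E @[k --> \oo] -->
    \int[mu]_(x in \bigcup_k F k) (arctan_density x)%:E)%E.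
  apply: ge0_nondecreasing_set_cvg_integral.
  - apply/nondecreasing_seqP => k; rewrite subsetEset => x; rewrite /F /= !in_itv /=.
    move=> /andP[h1 h2]; apply/andP; split.
      by apply: le_trans h1; rewrite lef_pV2 ?posrE // ler_nat.
    by apply: (le_trans h2); rewrite ler_nat.
  - by move=> k; exact: measurable_itv.
  - by move=> k; apply/measurable_EFinP; apply: measurable_funS mf => //; exact: FS.
  - by move=> k x /Fpos x0; rewrite lee_fin arctan_density_ge0.
apply: le_lt_trans (ltry pi); apply: (cvge_le _ cvgF).
apply: nearW => k; apply: integral_arctan_density; rewrite ?invr_gt0 //.
by apply: le_lt_trans (_ : 1 < _); rewrite ?invf_le1 ?ler1n ?ltr1n.
Qed.

End ArctanDensity.

Section RiemannSums.
Local Open Scope classical_set_scope.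
Variable R : realType.
Notation mu := (@lebesgue_measure R).
Notation D := (`]0, +oo[%classic : set R).

(** With cells closed on the right, [m / r < x] leaves out 0, where the limit
    density is singular. *)
Definition cell (r : R) (m : nat) : set R := `]m%:R / r, m.+1%:R / r].

Definition step_fun (r : R) N (c : nat -> R) (x : R) : R :=
  \sum_(m < N.+1) c m * \1_(cell r m) x.

Lemma cellP (r : R) m x : 0 < r -> cell r m x <-> m%:R < x * r <= m.+1%:R.
Proof.
by move=> r0; rewrite /cell /= in_itv /= ltr_pdivrMr // ler_pdivlMr.
Qed.

Definition cell_index (y : R) : nat := `|Num.ceil y|%N.-1.

Lemma cell_index_itv y : 0 < y -> (cell_index y)%:R < y <= (cell_index y).+1%:R.
Proof.
move=> y0; have /andP[h1 h2] := ceil_itv y.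
have c0 : 0 < Num.ceil y by rewrite ceil_gt0.
have cE : Num.ceil y = (cell_index y).+1%:Z.
  rewrite /cell_index prednK ?absz_gt0 ?gt_eqF //.
  by rewrite gez0_abs // ltW.
rewrite cE in h1 h2; rewrite h2 andbT; apply: le_lt_trans h1.
by rewrite -addn1 PoszD addrK.
Qed.

Lemma step_funE r N c m x : 0 < r -> cell r m x ->
  (forall k, (N < k)%N -> c k = 0) -> step_fun r N c x = c m.
Proof.
move=> r0 xm c0; have /cellP-/(_ r0)/andP[m1 m2] := xm.
have out (k : nat) : k <> m -> \1_(cell r k) x = 0 :> R.
  move=> km; rewrite indicE memNset // => /cellP-/(_ r0)/andP[k1 k2].
  apply: km; apply/eqP; rewrite eqn_leq -(ltnS k) -(ltnS m) -!(ltr_nat R).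
  by rewrite (lt_le_trans k1 m2) (lt_le_trans m1 k2).
have inm : \1_(cell r m) x = 1 :> R by rewrite indicE mem_set.
rewrite /step_fun; have [mN|Nm] := leqP m N.
  rewrite (bigD1 (Ordinal (mN : (m < N.+1)%N))) //= inm mulr1 big1 ?addr0 // => k km.
  by rewrite out ?mulr0 // => E; case/eqP: km; apply: val_inj.
rewrite c0 // big1 // => k _; rewrite out ?mulr0 // => E.
by have := ltn_ord k; rewrite E ltnS leqNgt Nm.
Qed.

Lemma measurable_cell r m : measurable (cell r m).
Proof. exact: measurable_itv. Qed.

Lemma cell_integrable r m (k : R) :
  mu.-integrable D (fun x : R => (k * \1_(cell r m) x)%:E).
Proof.
have h : mu.-integrable D (fun x : R => (\1_(cell r m) x)%:E).
  apply: (@integrableS _ _ _ _ setT) => //.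
  exact: integrable_indic_itv.
rewrite (_ : (fun x => _) = (fun x => k%:E * (\1_(cell r m) x)%:E)%E) //.
by apply: integrableZl => //; exact: measurable_itv.
Qed.

Lemma step_fun_integrable r N c : mu.-integrable D (EFin \o step_fun r N c).
Proof.
rewrite (_ : EFin \o _ = fun x => (\sum_(m < N.+1) (c m * \1_(cell r m) x)%:E)%E).
  by apply: integrable_sum => // m _; exact: cell_integrable.
by apply/funext => x; rewrite /= /step_fun -sumEFin.
Qed.

Lemma integral_step_fun r N c : 0 < r ->
  (\int[mu]_(x in D) (step_fun r N c x)%:E = (\sum_(m < N.+1) c m / r)%:E)%E.
Proof.
move=> r0; under eq_integral do rewrite /step_fun -sumEFin.
rewrite (@integral_sum _ _ _ mu D (measurable_itv _) _
  (fun (m : 'I_N.+1) (x : R) => (c m * \1_(cell r m) x)%:E)); last first.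
  by move=> m; exact: cell_integrable.
rewrite -sumEFin; apply: eq_bigr => m _.
under eq_integral do rewrite EFinM.
rewrite integralZl //; last first.
  apply: (@integrableS _ _ _ _ setT) => //.
  exact: integrable_indic_itv.
rewrite integral_indic; [|exact: measurable_itv|exact: measurable_cell].
rewrite (_ : cell r m `&` D = cell r m); last first.
  apply/setIidPl => x /=; rewrite /cell /= !in_itv /= andbT => /andP[+ _].
  by apply: le_lt_trans; rewrite divr_ge0 ?ler0n // ltW.
have mr : m%:R / r < m.+1%:R / r by rewrite ltr_pM2r ?invr_gt0 // ltr_nat.
rewrite /cell /= lebesgue_measure_itv /= lte_fin mr -EFinB -EFinM.
congr EFin; rewrite -[m.+1%:R]natr1; field.
by rewrite gt_eqF.
Qed.

End RiemannSums.

Section TwoPointLimit.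
Local Open Scope classical_set_scope.
Variables (R : realType) (s : R).
Notation mu := (@lebesgue_measure R).
Notation D := (`]0, +oo[%classic : set R).
Implicit Types (x a K : R) (N m : nat) (H : nat -> nat -> R).

(** Complete the square in [K x + x - x^2 / 8]. *)
Lemma expR_arctan_density x K : 0 < x ->
  expR (K * x - x ^+ 2 / 8) / Num.sqrt x <=
  expR (2 * (K + 1) ^+ 2) * arctan_density x.
Proof.
move=> x0; rewrite /arctan_density invfM [_^-1 / _]mulrC mulrA.
rewrite ler_wpM2r ?invr_ge0 ?sqrtr_ge0 //.
have x1 : 0 < 1 + x by rewrite ltr_pwDl // ltW.
rewrite ler_pdivlMr //.
apply: le_trans (_ : expR (K * x - x ^+ 2 / 8) * expR x <= _).
  by rewrite ler_wpM2l ?expR_ge0 // expR_ge1Dx.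
rewrite -expRD ler_expR -subr_ge0.
have -> : 2 * (K + 1) ^+ 2 - (K * x - x ^+ 2 / 8 + x) = (x - 4 * (K + 1)) ^+ 2 / 8.
  by field.
by rewrite divr_ge0 ?sqr_ge0.
Qed.

Lemma profile_density_continuous x : 0 < x -> {for x, continuous (profile_density s)}.
Proof.
move=> x0; apply: cvgM; last first.
  apply: cvgM; first exact: cvg_cst.
  apply: (@cvgV _ _ _ _ (@Num.sqrt R)); first by rewrite gt_eqF ?sqrtr_gt0.
  exact: sqrt_continuous.
apply: continuous_cvg; first exact: continuous_expR.
apply: cvgD; (apply: cvgM; [exact: cvg_cst|]); last exact: cvg_id.
exact: exprn_continuous.
Qed.

Lemma profile_density_ge0 x : 0 <= profile_density s x.
Proof. by rewrite mulr_ge0 ?expR_ge0 // divr_ge0 ?sqrtr_ge0. Qed.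

Lemma profile_density_integrable : mu.-integrable D (EFin \o profile_density s).
Proof.
pose C : R := expR (2 * (`|s| + 1) ^+ 2).
have mD : measurable D by exact: measurable_itv.
apply: (@le_integrable _ _ _ mu D mD (EFin \o profile_density s)
  (fun x : R => C%:E * (arctan_density x)%:E)%E).
- by apply/measurable_EFinP; apply: measurable_itv_continuous;
    exact: profile_density_continuous.
- move=> x; rewrite /= in_itv /= andbT => x0.
  rewrite lee_fin (ger0_norm (profile_density_ge0 x)) ger0_norm; last first.
    by rewrite mulr_ge0 ?expR_ge0 ?arctan_density_ge0.
  apply: le_trans (expR_arctan_density _ x0).
  rewrite /profile_density [1 / Num.sqrt x]div1r ler_wpM2r ?invr_ge0 ?sqrtr_ge0 // ler_expR.
  have h1 : s * x <= `|s| * x by rewrite ler_wpM2r ?ler_norm // ltW.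
  have h2 : 0 <= x ^+ 2 by rewrite sqr_ge0.
  by move: (s * x) (`|s| * x) (x ^+ 2) h1 h2 => u v w; lra.
- by apply: integrableZl => //; exact: arctan_density_integrable.
Qed.

(** The Gaussian factor comes from [falling_ratio_le], and the singularity
    [x^(-1/2)] from [x V^(1/2) <= m + 2]. *)
Lemma scaled_term_bound : exists2 K : R, 0 <= K & forall N m x, 0 < x ->
  `|s / sqrtV R N| <= 1 / 2 -> cell (sqrtV R N) m x ->
  `|scaled_term s N m| <= K * (expR (`|s| * x - x ^+ 2 / 2) / Num.sqrt x).
Proof.
have [S S0 HS] := stirling_bounded R.
exists (expR 1 * expR (1 + `|s|) * S); first by rewrite !mulr_ge0 ?expR_ge0 // ltW.
move=> N m x x0 hs /cellP-/(_ (sqrtV_gt0 R N))/andP[mx xm].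
have r0 := sqrtV_gt0 R N; have r1 := sqrtV_ge1 R N.
have n0 : 0 < m.+2%:R :> R by rewrite ltr0n.
have V0 : 0 < N.+2%:R :> R by rewrite ltr0n.
have hP : `|falling_ratio R N m| <= expR (1 - x ^+ 2 / 2).
  rewrite ger0_norm ?falling_ratio_ge0 //; apply: le_trans (falling_ratio_le _ _ _) _.
  rewrite ler_expR -subr_ge0.
  have V1 : 1 <= N.+2%:R :> R by rewrite ler1n.
  have xr : x ^+ 2 * N.+2%:R <= m.+1%:R * m.+2%:R.
    rewrite -(sqrtV_sqr R N) -exprMn expr2 ler_pM ?mulr_ge0 ?(ltW x0) ?(ltW r0) //.
    by apply: (le_trans xm); rewrite ler_nat.
  have -> : 1 - x ^+ 2 / 2 - - (m%:R * (m%:R + 3) / 2 / N.+2%:R) =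
      ((2 * N.+2%:R - 2) + (m.+1%:R * m.+2%:R - x ^+ 2 * N.+2%:R)) / (2 * N.+2%:R).
    rewrite -[m.+2%:R]natr1 -[m.+1%:R]natr1.
    by move: (N.+2%:R : R) V0 (m%:R : R) => V V0 k; field; rewrite gt_eqF.
  rewrite divr_ge0 ?mulr_ge0 ?(ltW V0) // addr_ge0 ?subr_ge0 //.
  by rewrite -[leLHS]mulr1 ler_wpM2l.
have hp : `|(1 + s / sqrtV R N) ^+ m.+1| <= expR (`|s| * x + `|s|).
  have u0 : 0 <= 1 + s / sqrtV R N.
    by move: hs; rewrite ler_norml => /andP[? _]; lra.
  rewrite ger0_norm ?exprn_ge0 //.
  apply: le_trans (_ : expR (`|s| / sqrtV R N) ^+ m.+1 <= _).
    rewrite lerXn2r ?nnegrE ?expR_ge0 //; apply: le_trans (expR_ge1Dx _) _.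
    by rewrite ler_expR ler_wpM2r ?invr_ge0 ?(ltW r0) ?ler_norm.
  rewrite -expRM_natl ler_expR mulrCA -[X in _ <= _ + X]mulr1 -mulrDr ler_wpM2l //.
  rewrite ler_pdivrMr // -natr1 mulrDl mul1r lerD // ltW //.
have hq : `|m.+1%:R / m.+2%:R| <= 1 :> R.
  by rewrite ger0_norm ?divr_ge0 // ler_pdivrMr // mul1r ler_nat.
have hr : `|Num.sqrt (sqrtV R N / m.+2%:R)| <= (Num.sqrt x)^-1.
  rewrite ger0_norm ?sqrtr_ge0 // -[(Num.sqrt x)^-1]sqrtrV ?(ltW x0) //.
  apply: ler_wsqrtr.
  rewrite ler_pdivrMr // ler_pdivlMl //; apply: (le_trans xm).
  by rewrite ler_nat.
have hS := HS m.+2.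
rewrite /scaled_term.
have -> : expR 1 * expR (1 + `|s|) * S * (expR (`|s| * x - x ^+ 2 / 2) / Num.sqrt x) =
    expR 1 * expR (1 - x ^+ 2 / 2) * expR (`|s| * x + `|s|) * S * 1 / Num.sqrt x.
  rewrite !expRD; ring.
do 4! (rewrite [leLHS]normrM; apply: ler_pM => //).
by rewrite normrM ger0_norm ?expR_ge0 // ler_wpM2l ?expR_ge0.
Qed.

(** The factor [H N m] may grow, as long as it leaves a part of the Gaussian
    decay: with the constant [3 / 8 < 1 / 2] there remains [exp (- x^2 / 8)] for
    [expR_arctan_density]. *)
Lemma two_point_sum_cvg (g K : R) H :
  (\forall N \near \oo, forall m,
     `|H N m| <= K * expR (3 / 8 * (m.+2%:R / sqrtV R N) ^+ 2)) ->
  (forall (m_ : nat -> nat) x, 0 < x ->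
     (m_ N)%:R / sqrtV R N @[N --> \oo] --> x -> H N (m_ N) @[N --> \oo] --> g) ->
  sqrtV R N * Num.sqrt (sqrtV R N) *
    two_point_sum N (window_fugacity s N) (H N) @[N --> \oo] --> g * profile s.
Proof.
move=> HK Hg.
have small : \forall N \near \oo, `|s / sqrtV R N| < 1 / 2.
  apply: (cvgr_norm_lt (s * 0)); last by rewrite mulr0 normr0.
  by apply: cvgM; [exact: cvg_cst|exact: inv_sqrtV_cvg0].
have [N0 _ HN0] : \forall N \near \oo, `|s / sqrtV R N| < 1 / 2 /\ forall m,
    `|H N m| <= K * expR (3 / 8 * (m.+2%:R / sqrtV R N) ^+ 2).
  by near=> N; split; near: N.
have K0 : 0 <= K.
  have [_ /(_ 0%N) h] := HN0 N0 (leqnn _).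
  by have := le_trans (normr_ge0 _) h; rewrite pmulr_lge0 ?expR_gt0.
have [S S0 HS] := scaled_term_bound.
pose c N m : R := scaled_term s N m * H N m.
(* The bound on H holds from N0 on only, so the sequence is shifted. *)
pose phi N : R -> R := step_fun (sqrtV R (N + N0)) (N + N0) (c (N + N0)%N).
pose k : R := expR 1 / Num.sqrt (2 * pi) * g.
pose A : R := `|s| + 3 / 2.
pose C : R := S * (K * expR (3 / 2)) * expR (2 * (A + 1) ^+ 2).
have C0 : 0 <= C by rewrite !mulr_ge0 ?expR_ge0.
have mD : measurable D by exact: measurable_itv.
have c_gtN N m : (N < m)%N -> c N m = 0.
  by move=> Nm; rewrite /c scaled_term_gtN ?mul0r.
have phiE N x : 0 < x -> phi N x =
    c (N + N0)%N (cell_index (x * sqrtV R (N + N0))).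
  move=> x0; apply: step_funE; [exact: sqrtV_gt0| |exact: c_gtN].
  apply/cellP; first exact: sqrtV_gt0.
  by apply: cell_index_itv; rewrite mulr_gt0 ?sqrtV_gt0.
have phi_bound N x : 0 < x -> `|phi N x| <= C * arctan_density x.
  move=> x0; rewrite phiE //; set N1 := (N + N0)%N.
  set m := cell_index _; rewrite /c normrM.
  have r0 := sqrtV_gt0 R N1; have r1 := sqrtV_ge1 R N1.
  have xm : cell (sqrtV R N1) m x.
    by apply/cellP => //; apply: cell_index_itv; rewrite mulr_gt0.
  have [/ltW hs hH] := HN0 N1 (leq_addl _ _).
  have h1 := HS N1 m x x0 hs xm.
  have h2 : `|H N1 m| <= K * expR (3 / 2) * expR (3 / 8 * x ^+ 2 + 3 / 2 * x).
    apply: (le_trans (hH m)); rewrite -[leRHS]mulrA ler_wpM2l // -expRD ler_expR.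
    have -> : 3 / 2 + (3 / 8 * x ^+ 2 + 3 / 2 * x) = 3 / 8 * (x + 2) ^+ 2 by field.
    rewrite ler_wpM2l ?divr_ge0 //.
    rewrite lerXn2r ?nnegrE ?divr_ge0 ?ler0n ?(ltW r0) ?addr_ge0 ?(ltW x0) //.
    rewrite ler_pdivrMr // mulrDl; have /cellP-/(_ r0)/andP[mx _] := xm.
    rewrite -[m.+2]addn2 natrD lerD ?(ltW mx) //.
    by rewrite -[leLHS]mulr1 ler_wpM2l.
  apply: le_trans (ler_pM (normr_ge0 _) (normr_ge0 _) h1 h2) _.
  set e1 := expR (_ - _); set e2 := expR (_ + 3 / 2 * x).
  have -> : S * (e1 / Num.sqrt x) * (K * expR (3 / 2) * e2) =
      S * (K * expR (3 / 2)) * (e1 * e2 / Num.sqrt x) by ring.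
  rewrite /C -[leRHS]mulrA ler_wpM2l ?mulr_ge0 ?expR_ge0 //.
  apply: le_trans (expR_arctan_density A x0).
  rewrite -expRD ler_wpM2r ?invr_ge0 ?sqrtr_ge0 // ler_expR /A.
  by rewrite le_eqVlt; apply/orP; left; apply/eqP; field.
have phi_cvg x : 0 < x -> phi N x @[N --> \oo] --> k * profile_density s x.
  move=> x0; pose m_ N := cell_index (x * sqrtV R N).
  have m_cvg : (m_ N)%:R / sqrtV R N @[N --> \oo] --> x.
    have lo : x - (sqrtV R N)^-1 @[N --> \oo] --> x.
      rewrite -[X in _ --> X]subr0.
      by apply: cvgB; [exact: cvg_cst|exact: inv_sqrtV_cvg0].
    apply: (squeeze_cvgr _ lo (cvg_cst x)); near=> N.
    have r0 := sqrtV_gt0 R N.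
    have /andP[h1 h2] : (m_ N)%:R < x * sqrtV R N <= (m_ N).+1%:R.
      by apply: cell_index_itv; rewrite mulr_gt0.
    rewrite ler_pdivlMr // ler_pdivrMr // (ltW h1) andbT.
    by rewrite mulrBl mulVf ?gt_eqF // lerBlDr natr1.
  have h : c N (m_ N) @[N --> \oo] --> k * profile_density s x.
    have -> : k * profile_density s x =
        expR 1 / Num.sqrt (2 * pi) * profile_density s x * g by rewrite /k; ring.
    by apply: cvgM (Hg _ _ x0 m_cvg); apply: scaled_term_cvg.
  move: h; rewrite -(cvg_shiftn N0) => h.
  by under eq_cvg do rewrite phiE //.
have [_ _ lim] : [/\ mu.-integrable D (fun x : R => (k * profile_density s x)%:E),
    ([sequence \int[mu]_(x in D) `|(phi n x)%:E - (k * profile_density s x)%:E|]_n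
      @ \oo --> 0)%E &
    ([sequence \int[mu]_(x in D) (phi n x)%:E]_n)%E @ \oo -->
      (\int[mu]_(x in D) (k * profile_density s x)%:E)%E].
  apply: (@dominated_convergence _ _ _ mu D mD (fun n (x : R) => (phi n x)%:E)
    (fun x : R => (k * profile_density s x)%:E)
    (fun x : R => (C * arctan_density x)%:E)).
  - by move=> n; have /integrableP[] := step_fun_integrable (sqrtV R (n + N0))
      (n + N0) (c (n + N0)%N).
  - apply/measurable_EFinP; apply: measurable_funM; first exact: measurable_cst.
    by apply: measurable_itv_continuous; exact: profile_density_continuous.
  - apply: aeW => x; rewrite /= in_itv /= andbT => x0.
    by apply: cvg_EFin; [exact: nearW | exact: phi_cvg].
  - rewrite (_ : (fun x : R => _) = (fun x => C%:E * (arctan_density x)%:E)%E) //.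
    by apply: integrableZl; [exact: measurable_itv|exact: arctan_density_integrable].
  - apply: aeW => x n; rewrite /= in_itv /= andbT => x0.
    by rewrite lee_fin phi_bound.
have intE : (\int[mu]_(x in D) (k * profile_density s x)%:E)%E = (g * profile s)%:E.
  under eq_integral do rewrite EFinM.
  rewrite integralZl //; last exact: profile_density_integrable.
  rewrite -[X in (_ * X)%E]fineK; last first.
    exact: integrable_fin_num profile_density_integrable.
  rewrite -EFinM; congr EFin; rewrite /k /profile /Rintegral; ring.
rewrite intE in lim.
have lim2 : fine (\int[mu]_(x in D) (phi N x)%:E)%E @[N --> \oo] --> g * profile s.
  exact: fine_cvg lim.
rewrite -(cvg_shiftn N0); apply: (cvg_trans _ lim2); apply: near_eq_cvg.
near=> N; rewrite /= integral_step_fun ?sqrtV_gt0 //=.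
set N1 := (N + N0)%N; rewrite /two_point_sum mulr_sumr; apply: eq_bigr => m _.
rewrite /c -scaled_termE -sqrtV_sqr; have r0 := sqrtV_gt0 R N1.
by field; rewrite gt_eqF.
Unshelve. all: by end_near. Qed.

End TwoPointLimit.

(** * The critical window *)

Section Asymptotics.
Local Open Scope classical_set_scope.
Variables (R : realType) (s : R).
Notation mu := (@lebesgue_measure R).
Notation D := (`]0, +oo[%classic : set R).
Notation z := (window_fugacity s).

Lemma profile_gt0 : 0 < profile s.
Proof.
have p0 := pi_gt0 R.
rewrite /profile mulr_gt0 ?divr_gt0 ?expR_gt0 ?sqrtr_gt0 ?mulr_gt0 //.
rewrite -[X in _ < X]/(fine (\int[mu]_(x in D) (profile_density s x)%:E)).
have fin : (\int[mu]_(x in D) (profile_density s x)%:E)%E \is a fin_num.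
  by apply: integrable_fin_num => //; exact: profile_density_integrable.
rewrite -lte_fin fineK //.
pose b : R := expR (- 2 - 2 * `|s|) / Num.sqrt 2.
have b0 : 0 < b by rewrite divr_gt0 ?expR_gt0 ?sqrtr_gt0.
apply: lt_le_trans (_ : (\int[mu]_(x in `]1%R, 2%R]) (cst b%:E) x <= _)%E).
  rewrite integral_cst; last exact: measurable_itv.
  rewrite /= lebesgue_measure_itv /= lte_fin ltr1n -EFinB -EFinM lte_fin.
  by rewrite mulr_gt0 // subr_gt0 ltr1n.
apply: le_trans (_ : (\int[mu]_(x in `]1%R, 2%R]) (profile_density s x)%:E <= _)%E).
  have mf : measurable_fun (`]1, 2]%classic : set R) (profile_density s).
    apply: (@measurable_funS _ _ _ _ D) => //.
      by move=> x /=; rewrite !in_itv /= andbT => /andP[+ _]; apply: lt_trans.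
    by apply: measurable_itv_continuous; exact: profile_density_continuous.
  apply: ge0_le_integral => //.
  - by move=> x _; rewrite lee_fin ltW.
  - exact/measurable_EFinP.
  - move=> x; rewrite /= in_itv /= => /andP[x1 x2]; rewrite lee_fin.
    have x0 : 0 < x by apply: lt_trans x1.
    rewrite /b /profile_density ler_pM ?expR_ge0 ?invr_ge0 ?sqrtr_ge0 //.
      have h1 : `|s * x| <= `|s| * 2 by rewrite normrM ler_wpM2l // ger0_norm // ltW.
      have h2 : x ^+ 2 <= 4.
        by rewrite (_ : 4 = 2 ^+ 2) ?lerXn2r ?nnegrE ?(ltW x0) // -natrX.
      move: h1; rewrite ler_norml => /andP[h1 _]; rewrite ler_expR.
      by move: (s * x) (x ^+ 2) (`|s|) h1 h2 => u v w; lra.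
    by rewrite div1r lef_pV2 ?posrE ?sqrtr_gt0 // ler_wsqrtr.
apply: ge0_subset_integral => //.
- apply/measurable_EFinP; apply: measurable_itv_continuous.
  exact: profile_density_continuous.
- by move=> x _; rewrite lee_fin profile_density_ge0.
- by move=> x /=; rewrite !in_itv /= andbT => /andP[+ _]; apply: lt_trans.
Qed.

(** From [p <= 6 / 5] and [e >= 2] follows [z n^2 <= (3 / 5) w], where
    [w = n^2 / V]. So [(1 + z)^('C(n, 2))] is at most [exp (3 w / 10)], and the
    factor [5 z n^2 <= 3 w] is at most [40 exp (3 w / 40)]. *)
Lemma excess_bound_window N m : `|s / sqrtV R N| <= 1 / 5 ->
  0 <= excess_bound m.+2 (z N) <=
  40 * expR (3 / 8 * (m.+2%:R / sqrtV R N) ^+ 2) * (Num.sqrt (Num.sqrt m.+2%:R))^-1.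
Proof.
move=> hs; have r0 := sqrtV_gt0 R N.
have /andP[p1 p2] : 4 / 5 <= 1 + s / sqrtV R N <= 6 / 5.
  by move: hs; rewrite ler_norml => /andP[? ?]; apply/andP; split; lra.
have e2 : 2 <= expR 1 :> R by have := expR_ge1Dx (1 : R); rewrite -natr1.
have V0 : 0 < N.+2%:R :> R by rewrite ltr0n.
have z0 : 0 <= z N.
  by rewrite /window_fugacity divr_ge0 ?mulr_ge0 ?expR_ge0 ?ler0n //; lra.
rewrite excess_bound_ge0 //=.
rewrite /excess_bound ler_wpM2r ?invr_ge0 ?sqrtr_ge0 //.
set n : R := m.+2%:R; set w : R := (n / sqrtV R N) ^+ 2.
have n0 : 0 <= n by rewrite /n ler0n.
have w0 : 0 <= w by rewrite sqr_ge0.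
have zw : n ^+ 2 * z N <= 3 / 5 * w.
  have -> : 3 / 5 * w = n ^+ 2 * (3 / 5 / N.+2%:R).
    by rewrite /w exprMn exprVn sqrtV_sqr; ring.
  rewrite ler_wpM2l ?sqr_ge0 //.
  rewrite /window_fugacity invfM mulrA ler_wpM2r ?invr_ge0 ?(ltW V0) //.
  rewrite ler_pdivrMr ?expR_gt0 //; apply: (le_trans p2).
  by apply: le_trans (_ : 3 / 5 * 2 <= _); [lra|rewrite ler_wpM2l].
have hp : (1 + z N) ^+ 'C(m.+2, 2) <= expR (3 / 10 * w).
  apply: le_trans (_ : expR (z N) ^+ 'C(m.+2, 2) <= _).
    by rewrite lerXn2r ?nnegrE ?addr_ge0 ?expR_ge0 // expR_ge1Dx.
  rewrite -expRM_natl ler_expR.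
  have hb : 'C(m.+2, 2)%:R <= n ^+ 2 / 2 :> R.
    rewrite ler_pdivlMr // -natrM -natrX ler_nat bin2 muln2.
    by rewrite (leq_trans (_ : _ <= m.+2 * m.+1)%N) ?leq_mul2l ?leqnSn ?orbT //
       -[leqRHS]odd_double_half leq_addl.
  apply: le_trans (ler_wpM2r z0 hb) _.
  rewrite mulrAC ler_pdivrMr //; apply: (le_trans zw).
  by move: w0; move: (w) => u u0; lra.
have -> : 3 / 8 * w = 3 / 10 * w + 3 / 40 * w by field.
rewrite expRD -[5 * _ * _]mulrA.
have h3 : 5 * (n ^+ 2 * z N) <= 40 * expR (3 / 40 * w).
  have h4 := expR_ge1Dx (3 / 40 * w).
  by move: h4 zw; move: (expR _) (n ^+ 2 * z N) => a b; lra.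
apply: le_trans (ler_pM _ _ h3 hp) _.
- by rewrite mulr_ge0 // mulr_ge0 ?sqr_ge0.
- by rewrite exprn_ge0 // addr_ge0.
- by rewrite le_eqVlt; apply/orP; left; apply/eqP; ring.
Qed.

Lemma window_near (e : R) : 0 < e -> \forall N \near \oo, `|s / sqrtV R N| <= e.
Proof.
move=> e0; have h : s / sqrtV R N @[N --> \oo] --> s * 0.
  by apply: cvgM; [exact: cvg_cst|exact: inv_sqrtV_cvg0].
by apply: (cvgr_norm_le (s * 0)) => //; rewrite mulr0 normr0.
Qed.

Lemma excess_bound_le N m : `|s / sqrtV R N| <= 1 / 5 ->
  0 <= excess_bound m.+2 (z N) <= 40 * expR (3 / 8 * (m.+2%:R / sqrtV R N) ^+ 2).
Proof.
move=> /(excess_bound_window m)/andP[-> /le_trans]; apply.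
rewrite -[leRHS]mulr1 ler_wpM2l ?mulr_ge0 ?expR_ge0 //.
have sqrt_ge1 (k : R) : 1 <= k -> 1 <= Num.sqrt k.
  by move=> k1; rewrite -[leLHS]sqrtr1 ler_wsqrtr.
rewrite invf_le1 ?sqrtr_gt0 ?ltr0n //.
by apply: (sqrt_ge1 _ (sqrt_ge1 _ _)); rewrite ler1n.
Qed.

Lemma excess_bound_cvg (m_ : nat -> nat) (x : R) : 0 < x ->
  (m_ N)%:R / sqrtV R N @[N --> \oo] --> x ->
  excess_bound (m_ N).+2 (z N) @[N --> \oo] --> 0.
Proof.
move=> x0 mx.
have c1 : expR (3 / 8 * ((m_ N + 2)%:R / sqrtV R N) ^+ 2) @[N --> \oo] -->
    expR (3 / 8 * (x * x)).
  apply: continuous_cvg; first exact: continuous_expR.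
  apply: cvgM; first exact: cvg_cst.
  by under eq_cvg do rewrite expr2; apply: cvgM; exact: shifted_cvg.
have c2 : (Num.sqrt (Num.sqrt (m_ N).+2%:R))^-1 @[N --> \oo] --> (0 : R).
  have h0 : @harmonic R (m_ N).+1 @[N --> \oo] --> (0 : R).
    apply: (cvg_comp (fun N => (m_ N).+1) (@harmonic R)); last exact: cvg_harmonic.
    apply/cvgnyPge => A; have /cvgnyPge/(_ A) := index_cvgy x0 mx.
    by apply: filterS => N; apply: leqW.
  have h1 : Num.sqrt (@harmonic R (m_ N).+1) @[N --> \oo] --> Num.sqrt (0 : R).
    by apply: continuous_cvg h0; exact: sqrt_continuous.
  have h2 : Num.sqrt (Num.sqrt (@harmonic R (m_ N).+1)) @[N --> \oo] -->
      Num.sqrt (Num.sqrt (0 : R)).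
    by apply: continuous_cvg h1; exact: sqrt_continuous.
  rewrite !sqrtr0 in h2; apply: (cvg_trans _ h2); apply: near_eq_cvg; near=> N.
  by rewrite /harmonic /= !sqrtrV ?sqrtr_ge0 // ler0n.
have up : 40 * expR (3 / 8 * ((m_ N + 2)%:R / sqrtV R N) ^+ 2) *
    (Num.sqrt (Num.sqrt (m_ N).+2%:R))^-1 @[N --> \oo] --> (0 : R).
  rewrite -(mulr0 (40 * expR (3 / 8 * (x * x)))).
  by apply: cvgM c2; apply: cvgM c1; exact: cvg_cst.
apply: (squeeze_cvgr _ (cvg_cst (0 : R)) up); near=> N.
rewrite addn2; apply: excess_bound_window; near: N; exact: window_near.
Unshelve. all: by end_near. Qed.

(** [V^(3/4)]. *)
Definition scale N : R := sqrtV R N * Num.sqrt (sqrtV R N).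

Lemma two_point_sum_cvg1 :
  scale N * two_point_sum N (z N) (fun=> 1) @[N --> \oo] --> profile s.
Proof.
rewrite -[profile s]mul1r.
apply: (@two_point_sum_cvg _ _ _ 1 (fun _ _ => 1)); last by move=> *; exact: cvg_cst.
apply: nearW => N m; rewrite normr1 mul1r -expR0 ler_expR.
by rewrite mulr_ge0 ?sqr_ge0 ?divr_ge0.
Qed.

Lemma excess_factor_bound N m : `|s / sqrtV R N| <= 1 / 5 ->
  0 <= 1 + excess_bound m.+2 (z N) <=
  41 * expR (3 / 8 * (m.+2%:R / sqrtV R N) ^+ 2).
Proof.
move=> /(excess_bound_le m)/andP[h1 h2]; rewrite addr_ge0 //=.
have h3 : 1 <= expR (3 / 8 * (m.+2%:R / sqrtV R N) ^+ 2).
  by rewrite -expR0 ler_expR mulr_ge0 ?sqr_ge0 ?divr_ge0.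
by move: (expR _) h2 h3 => a; lra.
Qed.

Lemma two_point_sum_cvg_excess :
  scale N * two_point_sum N (z N) (fun m => 1 + excess_bound m.+2 (z N))
    @[N --> \oo] --> profile s.
Proof.
rewrite -[profile s]mul1r.
apply: (@two_point_sum_cvg _ _ _ 41 (fun N m => 1 + excess_bound m.+2 (z N))).
  near=> N => m; have /andP[h1 h2] : 0 <= 1 + excess_bound m.+2 (z N) <=
      41 * expR (3 / 8 * (m.+2%:R / sqrtV R N) ^+ 2).
    by apply: excess_factor_bound; near: N; exact: window_near.
  by rewrite ger0_norm.
move=> m_ x x0 mx; rewrite -[X in _ --> X]addr0.
by apply: cvgD; [exact: cvg_cst|exact: excess_bound_cvg mx].
Unshelve. all: by end_near. Qed.

Lemma two_point_sum_cvg_one_point :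
  scale N * two_point_sum N (z N)
    (fun m => (1 + excess_bound m.+2 (z N)) / m.+1%:R) @[N --> \oo] --> (0 : R).
Proof.
rewrite -(mul0r (profile s)).
apply: (@two_point_sum_cvg _ _ _ 41
  (fun N m => (1 + excess_bound m.+2 (z N)) / m.+1%:R)).
  near=> N => m; have /andP[h1 h2] : 0 <= 1 + excess_bound m.+2 (z N) <=
      41 * expR (3 / 8 * (m.+2%:R / sqrtV R N) ^+ 2).
    by apply: excess_factor_bound; near: N; exact: window_near.
  rewrite ger0_norm ?divr_ge0 //; apply: le_trans h2.
  by rewrite ler_pdivrMr // ler_peMr // ler1n.
move=> m_ x x0 mx; rewrite -(mulr0 (1 + 0)); apply: cvgM.
  by apply: cvgD; [exact: cvg_cst|exact: excess_bound_cvg mx].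
by apply: (cvg_comp m_ (@harmonic R)); [exact: index_cvgy mx|exact: cvg_harmonic].
Unshelve. all: by end_near. Qed.

Variable F : forall V : nat, {set graph_on V}.
Hypothesis FE : trees_or_connected F.

Let p N : R := 1 + s / sqrtV R N.

Let p_ge0 N : `|s / sqrtV R N| <= 1 / 5 -> 0 <= p N.
Proof. by rewrite /p ler_norml => /andP[? ?]; lra. Qed.

Lemma scaled_two_point_cvg : scale N * two_point F N.+2 (p N) @[N --> \oo] --> profile s.
Proof.
apply: (squeeze_cvgr _ two_point_sum_cvg1 two_point_sum_cvg_excess); near=> N.
have hs : `|s / sqrtV R N| <= 1 / 5 by near: N; exact: window_near.
have /andP[h1 h2] := two_point_bounds N FE (p_ge0 hs).
have a0 : 0 <= scale N by rewrite mulr_ge0 ?sqrtr_ge0.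
by rewrite !ler_wpM2l.
Unshelve. all: by end_near. Qed.

Lemma scaled_one_point_cvg :
  one_point F N.+2 (p N) / Num.sqrt (sqrtV R N) @[N --> \oo] --> (0 : R).
Proof.
have c1 : (Num.sqrt (sqrtV R N))^-1 @[N --> \oo] --> (0 : R).
  have h : Num.sqrt (sqrtV R N)^-1 @[N --> \oo] --> Num.sqrt (0 : R).
    by apply: continuous_cvg; [exact: sqrt_continuous|exact: inv_sqrtV_cvg0].
  rewrite sqrtr0 in h; apply: (cvg_trans _ h); apply: near_eq_cvg; near=> N.
  by rewrite sqrtrV // ltW // sqrtV_gt0.
have up : 6 * (Num.sqrt (sqrtV R N))^-1 + scale N * two_point_sum N (z N)
    (fun m => (1 + excess_bound m.+2 (z N)) / m.+1%:R) @[N --> \oo] --> (0 : R).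
  rewrite -[X in _ --> X]addr0 -[X in _ --> X + _](mulr0 6).
  apply: cvgD two_point_sum_cvg_one_point.
  by apply: cvgM c1; exact: cvg_cst.
apply: (squeeze_cvgr _ (cvg_cst (0 : R)) up); near=> N.
have hs : `|s / sqrtV R N| <= 1 / 5 by near: N; exact: window_near.
have /andP[h1 h2] := one_point_bounds N FE (p_ge0 hs).
have r0 := sqrtV_gt0 R N; have q0 : 0 < Num.sqrt (sqrtV R N) by rewrite sqrtr_gt0.
rewrite divr_ge0 ?(ltW q0) //= ler_pdivrMr // mulrDl mulfVK ?gt_eqF //.
apply: (le_trans h2); apply: lerD.
  have z1 : z N <= 1.
    rewrite ler_pdivrMr ?mulr_gt0 ?expR_gt0 // mul1r.
    have e1 := expR_ge1Dx (1 : R).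
    have V2 : 2 <= N.+2%:R :> R by rewrite ler_nat.
    apply: le_trans (_ : 2 * 2 <= _); last by rewrite ler_pM //; lra.
    by move: hs; rewrite ler_norml => /andP[_ ?]; lra.
  rewrite /excess_bound bin_small // expr0 mulr1 expr1n !sqrtr1 divr1 mulr1.
  by rewrite -/(z N); lra.
set S := two_point_sum _ _ _.
have S0 : 0 <= S.
  apply: sumr_ge0 => m _; rewrite mulr_ge0 ?divr_ge0 ?ler0n //.
    rewrite mulr_ge0 ?ler0n ?tree_weight_ge0 //.
    by rewrite divr_ge0 ?mulr_ge0 ?expR_ge0 ?ler0n ?p_ge0.
  by have /andP[] := excess_factor_bound m hs.
rewrite mulrAC ler_wpM2r // /scale -mulrA -expr2 sqr_sqrtr ?(ltW r0) // -expr2 sqrtV_sqr.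
by rewrite ler_nat.
Unshelve. all: by end_near. Qed.

Lemma scaled_susceptibility_cvg :
  susceptibility F N.+2 (p N) / Num.sqrt (sqrtV R N) @[N --> \oo] --> profile s.
Proof.
have c1 : 1 - N.+2%:R^-1 @[N --> \oo] --> (1 - 0 : R).
  apply: cvgB; first exact: cvg_cst.
  by have := @cvg_harmonic R; rewrite -(cvg_shiftS (@harmonic R)).
have h : one_point F N.+2 (p N) / Num.sqrt (sqrtV R N) +
    (1 - N.+2%:R^-1) * (scale N * two_point F N.+2 (p N)) @[N --> \oo] -->
    0 + (1 - 0) * profile s.
  apply: cvgD; first exact: scaled_one_point_cvg.
  by apply: cvgM c1 _; exact: scaled_two_point_cvg.
rewrite subr0 mul1r add0r in h; apply: (cvg_trans _ h); apply: near_eq_cvg; near=> N.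
have q0 : Num.sqrt (sqrtV R N) != 0 by rewrite gt_eqF // sqrtr_gt0 sqrtV_gt0.
have r0 : sqrtV R N != 0 by rewrite gt_eqF // sqrtV_gt0.
have q2 : sqrtV R N = Num.sqrt (sqrtV R N) ^+ 2 by rewrite sqr_sqrtr // ltW // sqrtV_gt0.
rewrite /susceptibility /scale -sqrtV_sqr; move: q2 q0 r0.
move: (one_point _ _ _) (two_point _ _ _) (sqrtV R N) (Num.sqrt _) => a b r q -> q0 r0.
by field; rewrite q0.
Unshelve. all: by end_near. Qed.

Lemma sqrtV_powR N : sqrtV R N = N.+2%:R `^ (1 / 2).
Proof. by rewrite div1r powR12_sqrt ?ler0n. Qed.

Lemma sqrt_sqrtV_powR N : Num.sqrt (sqrtV R N) = N.+2%:R `^ (1 / 4).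
Proof.
rewrite sqrtV_powR (_ : 1 / 4 = 1 / 2 * 2^-1 :> R); last by field.
by rewrite (powRrM _ (1 / 2)) powR12_sqrt ?powR_ge0.
Qed.

Lemma windowE N : window s N.+2 = p N.
Proof. by rewrite /window powRN -sqrtV_powR. Qed.

Lemma asymp_two_point : asymp_equiv (fun V => two_point F V (window s V))
  (fun V => V%:R `^ (- (3 / 4)) * profile s).
Proof.
have I0 : profile s != 0 by rewrite gt_eqF // profile_gt0.
rewrite /asymp_equiv -(cvg_shiftn 2).
have h : scale N * two_point F N.+2 (p N) * (profile s)^-1 @[N --> \oo] -->
    profile s * (profile s)^-1.
  by apply: cvgM; [exact: scaled_two_point_cvg|exact: cvg_cst].
rewrite divff // in h; apply: (cvg_trans _ h); apply: near_eq_cvg; near=> N.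
rewrite /= addn2 windowE powRN.
have -> : scale N = N.+2%:R `^ (3 / 4).
  rewrite /scale sqrt_sqrtV_powR sqrtV_powR -powRD; last by rewrite pnatr_eq0 implybT.
  by congr (_ `^ _); field.
move: (profile s) (two_point _ _ _) (_ `^ _) => I t w.
by rewrite invfM invrK mulrA (mulrC w).
Unshelve. all: by end_near. Qed.

Lemma asymp_susceptibility : asymp_equiv (fun V => susceptibility F V (window s V))
  (fun V => V%:R `^ (1 / 4) * profile s).
Proof.
have I0 : profile s != 0 by rewrite gt_eqF // profile_gt0.
rewrite /asymp_equiv -(cvg_shiftn 2).
have h : susceptibility F N.+2 (p N) / Num.sqrt (sqrtV R N) * (profile s)^-1
    @[N --> \oo] --> profile s * (profile s)^-1.
  by apply: cvgM; [exact: scaled_susceptibility_cvg|exact: cvg_cst].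
rewrite divff // in h; apply: (cvg_trans _ h); apply: near_eq_cvg; near=> N.
rewrite /= addn2 windowE sqrt_sqrtV_powR.
by move: (profile s) (susceptibility _ _ _) => I t; rewrite invfM mulrA.
Unshelve. all: by end_near. Qed.

End Asymptotics.

Theorem theorem1p1 (R : realType) (s : R) :
  (asymp_equiv (fun V : nat => two_point trees V (window s V))
               (fun V : nat => V%:R `^ (- (3 / 4)) * profile s) /\
   asymp_equiv (fun V : nat => susceptibility trees V (window s V))
               (fun V : nat => V%:R `^ (1 / 4) * profile s)) /\
  (asymp_equiv (fun V : nat => two_point connected_subgraphs V (window s V))
               (fun V : nat => V%:R `^ (- (3 / 4)) * profile s) /\
   asymp_equiv (fun V : nat => susceptibility connected_subgraphs V (window s V))
               (fun V : nat => V%:R `^ (1 / 4) * profile s)).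
Proof.
by split; split; [apply: asymp_two_point|apply: asymp_susceptibility
                 |apply: asymp_two_point|apply: asymp_susceptibility];
  rewrite /trees_or_connected; by [left|right].
Qed.
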